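(* Let $E$ be a Banach space with a separable quotient. Then the following assertions are equivalent: (1) $E^*$ is weak$^*$-separable. (2) For every closed infinite-codimensional subspace $X\subset E$ such that $E/X$ has a separable quotient and every $R\in\mathcal R_d(E)$ with $X\subset R$ there exists a quasicomplement $Y$ of $X$ such that $R\cap Y=\{0\}$. (3) For some closed separable infinite-codimensional subspace $X\subset E$ such that $E/X$ has a separable quotient and every $R\in\mathcal R_d(E)$ with $X\subset R$ there is a quasicomplement $Y$ of $X$ such that $R\cap Y=\{0\}$.
   Context: All spaces are real. A Banach space $E$ has a separable quotient if there is a closed subspace $N\subset E$ such that $E/N$ is infinite-dimensional and separable. A linear subspace $R\subset E$ is an operator range in $E$ if there exist a Banach space $G$ and a bounded linear operator $A:G\to E$ with $A(G)=R$. $\mathcal R_d(E)$ denotes the class of proper (i.e. $\neq E$) dense operator ranges in $E$. A closed subspace $Y\subset E$ is a quasicomplement of a closed subspace $X\subset E$ if $X+Y$ is dense in $E$ and $X\cap Y=\{0\}$.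
   Formalization: In assertion (2) the subspace X is additionally assumed infinite-dimensional; without this (2) fails for X = {0} (its only quasicomplement is Y = E, so R∩Y = R ≠ {0}), even in E = l_2 where (1) holds. *)

(* Defs.v *)
From HB Require Import structures.
From mathcomp Require Import all_boot all_order all_algebra ring_quotient.
From mathcomp Require Import all_classical all_reals interval_inference topology.
From mathcomp Require Import normedtype.

Set Implicit Arguments.
Unset Strict Implicit.
Unset Printing Implicit Defensive.

Import Order.TTheory GRing.Theory Num.Theory.
Import numFieldTopology.Exports numFieldNormedType.Exports.

Local Open Scope classical_set_scope.
Local Open Scope ring_scope.
Local Open Scope quotient_scope.

Definition separable_space (T : topologicalType) : Prop :=
  exists2 D : set T, countable D & dense D.

Definition finite_dimensional (R : realType) (V : lmodType R) (A : set V) :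
    Prop :=
  exists (n : nat) (v : 'I_n -> V), (forall i, A (v i)) /\
    forall x, A x -> exists a : 'I_n -> R, x = \sum_(i < n) a i *: v i.

Definition infinite_dimensional (R : realType) (V : lmodType R) (A : set V) :
    Prop := ~ finite_dimensional A.

Record closedSubspace (R : realType) (E : normedModType R) := ClosedSubspace {
  closedSubspace_set :> set E;
  closedSubspace_submod : submod_closed [pred x | x \in closedSubspace_set];
  closedSubspace_closed : closed closedSubspace_set }.

Definition closedSubspace_pred (R : realType) (E : normedModType R)
  (X : closedSubspace E) : {pred E} :=
  [pred x | x \in (X : set E)].

HB.instance Definition _ (R : realType) (E : normedModType R)
    (X : closedSubspace E) :=
  GRing.isSubmodClosed.Build R E (closedSubspace_pred X)
    (closedSubspace_submod X).

Definition quotient_space (R : realType) (E : normedModType R)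
  (X : closedSubspace E) : Type := Quotient.quot (closedSubspace_pred X).

HB.instance Definition _ (R : realType) (E : normedModType R)
    (X : closedSubspace E) := GRing.Zmodule.on (quotient_space X).
HB.instance Definition _ (R : realType) (E : normedModType R)
    (X : closedSubspace E) := EqQuotient.on (quotient_space X).

Section Quotient.
Variables (R : realType) (E : normedModType R) (X : closedSubspace E).
Notation Q := (quotient_space X).
Implicit Types (p q : Q) (x y : E).

Definition quotient_pi (x : E) : Q := \pi x.

Lemma quotient_piD x y : quotient_pi (x + y) = quotient_pi x + quotient_pi y.
Proof. exact: Quotient.pi_add. Qed.

Lemma quotient_pi_eq x y :
  (quotient_pi x = quotient_pi y) <-> (X : set E) (x - y).
Proof.
by split=> [/eqP|h]; [|apply/eqP]; rewrite -Quotient.idealrBE inE.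
Qed.

Lemma quotient_piK q : quotient_pi (repr q) = q.
Proof. exact: reprK. Qed.

Lemma closedSubspace0 : (X : set E) 0.
Proof. by have [] := closedSubspace_submod X; rewrite inE. Qed.

Lemma closedSubspaceZD a x y :
  (X : set E) x -> (X : set E) y -> (X : set E) (a *: x + y).
Proof.
by move=> hx hy; have [_ /(_ a x y)] := closedSubspace_submod X;
  rewrite !inE; apply.
Qed.

Lemma closedSubspaceZ a x : (X : set E) x -> (X : set E) (a *: x).
Proof. by rewrite -[a *: x]addr0 => h; exact: closedSubspaceZD closedSubspace0. Qed.

Definition quotient_scale (a : R) q : Q := quotient_pi (a *: repr q).

Lemma quotient_scale_pi a x :
  quotient_scale a (quotient_pi x) = quotient_pi (a *: x).
Proof.
apply/quotient_pi_eq; rewrite -scalerBr; apply: closedSubspaceZ.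
by apply/quotient_pi_eq; rewrite quotient_piK.
Qed.

Let scaleA a b q :
  quotient_scale a (quotient_scale b q) = quotient_scale (a * b) q.
Proof. by rewrite -[q]quotient_piK !quotient_scale_pi scalerA. Qed.

Let scale1 : left_id 1 quotient_scale.
Proof. by move=> q; rewrite -[q]quotient_piK quotient_scale_pi scale1r. Qed.

Let scaleDr : right_distributive quotient_scale +%R.
Proof.
move=> a p q; rewrite -[p]quotient_piK -[q]quotient_piK.
by rewrite -quotient_piD !quotient_scale_pi scalerDr quotient_piD.
Qed.

Let scaleDl q : {morph quotient_scale^~ q : a b / a + b}.
Proof.
move=> a b; rewrite -[q]quotient_piK !quotient_scale_pi.
by rewrite scalerDl quotient_piD.
Qed.

HB.instance Definition _ := GRing.Zmodule_isLmodule.Build R Q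
  scaleA scale1 scaleDr scaleDl.

Lemma quotient_piZ a x : quotient_pi (a *: x) = a *: quotient_pi x.
Proof. by rewrite -quotient_scale_pi. Qed.

Lemma quotient_pi_is_linear : linear quotient_pi.
Proof. by move=> a x y; rewrite quotient_piD quotient_piZ. Qed.

HB.instance Definition _ :=
  GRing.isLinear.Build R E Q _ quotient_pi quotient_pi_is_linear.

Definition quotient_norm q : R := inf [set `|x| | x in quotient_pi @^-1` [set q]].

Let norm_nonempty q : [set `|x| | x in quotient_pi @^-1` [set q]] !=set0.
Proof. by exists `|repr q|; exists (repr q) => //=; exact: quotient_piK. Qed.

Let norm_lb q : lbound [set `|x| | x in quotient_pi @^-1` [set q]] 0.
Proof. by move=> _ [x _ <-]. Qed.

Let norm_has_inf q : has_inf [set `|x| | x in quotient_pi @^-1` [set q]].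
Proof. by split=> //; exists 0. Qed.

Lemma quotient_norm_ge0 q : 0 <= quotient_norm q.
Proof. exact: lb_le_inf. Qed.

Lemma quotient_norm_le x : quotient_norm (quotient_pi x) <= `|x|.
Proof. by apply: ge_inf; [exists 0|exists x]. Qed.

Lemma quotient_norm_lt q e : 0 < e ->
  exists2 x, quotient_pi x = q & `|x| < quotient_norm q + e.
Proof.
by move=> e0; have [_ [x <- <-] ?] := inf_adherent e0 (norm_has_inf q); exists x.
Qed.

Let ler_quotient_normD p q :
  quotient_norm (p + q) <= quotient_norm p + quotient_norm q.
Proof.
apply/ler_addgt0Pr => e e0; have e2 : 0 < e / 2 by rewrite divr_gt0.
have [x <- xp] := quotient_norm_lt p e2.
have [y <- yq] := quotient_norm_lt q e2.
rewrite -quotient_piD (le_trans (quotient_norm_le _))//.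
rewrite (le_trans (ler_normD _ _))// [e]splitr addrACA.
by rewrite lerD// ltW.
Qed.

Let quotient_normZ_le a q : quotient_norm (a *: q) <= `|a| * quotient_norm q.
Proof.
have [->|a0] := eqVneq a 0.
  rewrite normr0 mul0r scale0r -(raddf0 quotient_pi).
  by rewrite (le_trans (quotient_norm_le _))// normr0.
rewrite mulrC -ler_pdivrMr ?normr_gt0//; apply: lb_le_inf => //.
move=> _ [x <- <-]; rewrite ler_pdivrMr ?normr_gt0// -quotient_piZ.
by rewrite mulrC -normrZ quotient_norm_le.
Qed.

Let quotient_normZ a q : quotient_norm (a *: q) = `|a| * quotient_norm q.
Proof.
apply/le_anti; rewrite quotient_normZ_le/=.
have [->|a0] := eqVneq a 0; first by rewrite normr0 mul0r quotient_norm_ge0.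
rewrite mulrC -ler_pdivlMr ?normr_gt0// mulrC -normfV.
by rewrite -{1}[q](scalerK a0) quotient_normZ_le.
Qed.

Let quotient_norm0_eq0 q : quotient_norm q = 0 -> q = 0.
Proof.
move=> q0; rewrite -[q]quotient_piK -(raddf0 quotient_pi).
apply/quotient_pi_eq; rewrite subr0; apply: (@closedSubspace_closed _ _ X).
move=> B /nbhs_ballP[e /= e0 eB].
have [x xq] := quotient_norm_lt q e0; rewrite q0 add0r => xe.
exists (repr q - x); split.
  by apply/quotient_pi_eq; rewrite quotient_piK.
by apply: eB; rewrite -ball_normE /= opprB addrCA subrr addr0.
Qed.

HB.instance Definition _ := Lmodule_isNormed.Build R Q
  ler_quotient_normD quotient_normZ quotient_norm0_eq0.

Lemma quotient_normE q : `|q| = quotient_norm q. Proof. by []. Qed.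

Lemma ler_quotient_pi x : `|quotient_pi x| <= `|x|.
Proof. exact: quotient_norm_le. Qed.

Lemma quotient_pi_lift x q e : `|q - quotient_pi x| < e ->
  exists2 y, quotient_pi y = q & `|y - x| < e.
Proof.
move=> qxe; have e0 : 0 < e - `|q - quotient_pi x| by rewrite subr_gt0.
have [z zE] := quotient_norm_lt (q - quotient_pi x) e0.
rewrite -quotient_normE addrC subrK => ze.
by exists (z + x); rewrite ?addrK// quotient_piD zE subrK.
Qed.

End Quotient.

Section QuotientComplete.
Variables (R : realType) (E : completeNormedModType R) (X : closedSubspace E).
Notation Q := (quotient_space X).

Let e (n : nat) : R := 2^-1 ^+ n.

Let e_gt0 n : 0 < e n. Proof. by rewrite exprn_gt0// invr_gt0. Qed.

Let eS n : e n = e n.+1 *+ 2.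
Proof. by rewrite [e n.+1]exprS mulrC; exact: splitr. Qed.

Let e_small (d : R) : 0 < d -> \forall n \near \oo, e n < d.
Proof.
move=> /posnumP[{}d]; near=> n; apply: (@le_lt_trans _ _ n.+1%:R^-1).
  rewrite /e exprVn lef_pV2 ?posrE ?exprn_gt0 ?ltr0n// -natrX ler_nat.
  exact: ltn_expl.
by near: n; apply: near_infty_natSinv_lt.
Unshelve. all: by end_near. Qed.

Let quotient_complete (F : set_system Q) :
  ProperFilter F -> cauchy F -> cvg F.
Proof.
move=> FF /cauchyP cF.
have /choice[q Fq] n : exists p : Q, F (ball p (e n)) by exact: cF.
have qS n : `|q n.+1 - q n| < e n *+ 2.
  have [p [pn pS]] := filter_ex (filterI (Fq n) (Fq n.+1)).
  rewrite -(subrK p (q n.+1)) -addrA (le_lt_trans (ler_normD _ _))//.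
  rewrite mulr2n ltrD//; last by move: pn; rewrite -ball_normE /= distrC.
  move: pS; rewrite -ball_normE /= => /lt_le_trans; apply.
  by rewrite (eS n) mulr2n lerDl ltW.
have /choice[g gP] (nx : nat * E) : exists y : E,
    quotient_pi X nx.2 = q nx.1 ->
    quotient_pi X y = q nx.1.+1 /\ `|y - nx.2| < e nx.1 *+ 2.
  case: nx => n x /=; have [xq|nxq] := pselect (quotient_pi X x = q n).
    have [|y yq yx] := @quotient_pi_lift _ _ X x (q n.+1) (e n *+ 2).
      by rewrite xq.
    by exists y.
  by exists x => /nxq.
pose u := fix u n := if n is m.+1 then g (m, u m) else repr (q 0%N).
have uq n : quotient_pi X (u n) = q n.
  by elim: n => [|n ih]; [exact: quotient_piK|have [] := gP (n, u n) ih].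
have uS n : `|u n.+1 - u n| < e n *+ 2.
  by have [] := gP (n, u n) (uq n).
have uD n k : `|u (n + k)%N - u n| <= (e n - e (n + k)%N) *+ 4.
  elim: k => [|k ih]; first by rewrite addn0 !subrr normr0 mul0rn.
  rewrite addnS -(subrK (u (n + k)%N) (u (n + k).+1)) -addrA.
  rewrite (le_trans (ler_normD _ _))// (le_trans (lerD (ltW (uS _)) ih))//.
  rewrite (eS (n + k)).
  by rewrite !mulrnBl -mulrnA addrCA lerD2l// -mulrnA -opprB lerN2 -mulrnBr.
have cu : cvg (u @ \oo).
  apply: cauchy_cvg; apply/cauchyP => d d0.
  have [n _ nd] : \forall n \near \oo, e n < d / 4.
    by apply: e_small; rewrite divr_gt0.
  exists (u n); exists n => // m /= /subnKC <-.
  rewrite -ball_normE /= distrC (le_lt_trans (uD _ _))//.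
  rewrite (@le_lt_trans _ _ (e n *+ 4))//; last first.
    by rewrite -mulr_natr -ltr_pdivlMr// nd /=.
  by rewrite lerMn2r lerBlDr lerDl ltW ?orbT.
apply/cvg_ex; exists (quotient_pi X (lim (u @ \oo))).
apply/cvg_ballP => d d0.
have d2 : 0 < d / 2 by rewrite divr_gt0.
have /cvgrPdist_lt/(_ _ d2) ulim := cu.
have [n [nd un]] := filter_ex (filterI (e_small d2) ulim).
apply: filterS (Fq n) => p; rewrite -!ball_normE /= => pn.
rewrite -(subrK (q n) (quotient_pi X _)) -addrA (le_lt_trans (ler_normD _ _))//.
rewrite [d]splitr ltrD ?(lt_trans pn)// -uq -raddfB.
exact: le_lt_trans (ler_quotient_pi _ _) un.
Qed.

HB.instance Definition _ := Uniform_isComplete.Build Q quotient_complete.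

End QuotientComplete.

Definition has_separable_quotient (R : realType) (E : completeNormedModType R) :
    Prop :=
  exists N : closedSubspace E,
    infinite_dimensional [set: quotient_space N] /\
    separable_space (quotient_space N).

Definition infinite_codimensional (R : realType) (E : normedModType R)
    (X : closedSubspace E) : Prop :=
  infinite_dimensional [set: quotient_space X].

Definition operator_range (R : realType) (E : completeNormedModType R)
    (S : set E) : Prop :=
  exists (G : completeNormedModType R) (A : {linear G -> E}),
    continuous A /\ range A = S.

Definition proper_dense_operator_range (R : realType)
    (E : completeNormedModType R) (S : set E) : Prop :=
  [/\ operator_range S, S <> setT & dense S].

Definition quasicomplement (R : realType) (E : normedModType R)
    (X Y : closedSubspace E) : Prop :=
  dense [set x + y | x in (X : set E) & y in (Y : set E)] /\
  (X : set E) `&` (Y : set E) = [set 0].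

(* [{ptws E -> R}] carries the topology of pointwise convergence, so the
   subtype topology on the set of bounded functionals is the weak* topology. *)
Definition weak_star_dual (R : realType) (E : normedModType R) :
    topologicalType :=
  set_type [set f : {ptws E -> R^o} |
    linear (f : E -> R^o) /\ continuous (f : E -> R^o)].

(* Main.v *)
(** The heart is (1) => (2).  Let S = range A be a proper dense operator range
    containing X.  The map G -> E/X induced by A has dense range but is not onto, so its
    adjoint is not bounded below, and a gliding hump yields functionals th_k
    vanishing on X and biorthogonal to a bounded sequence x_k, with
    th_k = O(rho_k) on S for any prescribed rate rho_k; put N = cap_k ker th_k.
    For a total sequence of functionals, perturbed into (h_k) so as to be
    triangular with respect to some unit vectors z_k of X, let
    T y = sum_k alpha_k h_k(y) x_k with alpha_k decreasing fast and |T| <= 1/2,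
    and Y = {y | y - T y in N}.  If y in S cap Y then
    alpha_k h_k(y) = th_k(y) = O(rho_k), which forces y = 0.  As I - T is an
    isomorphism mapping X + Y onto T X + N, density of X + Y means that a
    functional phi killing N and all T z_j is zero: triangularity and the decay
    of alpha give phi(x_k) = 0 for all k, and each r in S is
    sum_k th_k(r) x_k modulo N.

    For (3) => (1), a closed N containing X with E/N infinite-dimensional and
    separable lies in a proper dense operator range {x | sup_n |f_n x| < oo}, so
    the quasicomplement Y satisfies N cap Y = 0 while E/N and E/Y are separable;
    their functionals together are total on E.  For (2) => (3), a biorthogonal
    sequence of E modulo N is split into its even and odd halves. *)
From HB Require Import structures.
Require Import Defs.
From mathcomp Require Import all_boot all_order all_algebra.
From mathcomp Require Import all_classical all_reals interval_inference topology normedtype sequences.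
From mathcomp Require Import lra.

Set Implicit Arguments.
Unset Strict Implicit.
Unset Printing Implicit Defensive.

Import Order.TTheory GRing.Theory Num.Theory.
Import numFieldTopology.Exports numFieldNormedType.Exports.

Local Open Scope classical_set_scope.
Local Open Scope ring_scope.

(** * The Hahn-Banach theorem *)

Definition linear_of (R : pzRingType) (U : lmodType R) (V : zmodType)
    (s : GRing.Scale.law R V) (f : U -> V) (lf : linear_for s f) :
    {linear U -> V | s} :=
  HB.pack f (GRing.isLinear.Build R U V s f lf).

Section HahnBanach.
Variables (R : realType) (V : lmodType R).
Implicit Types (p q : V -> R) (u x y : V).

Definition sublinear p :=
  [/\ p 0 = 0, forall x y, p (x + y) <= p x + p y &
      forall a x, 0 < a -> p (a *: x) = a * p x].

Lemma sublinear_ge p x : sublinear p -> - p (- x) <= p x.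
Proof. by case=> p0 pD _; have := pD x (- x); rewrite subrr p0; lra. Qed.

(** The auxiliary functional of Hahn-Banach. It is sublinear and below [p], and the choice t = 1 at
    [- u] gives [tilt p u (- u) <= - p u]; a linear functional below it is therefore at least [p u]
    at [u]. *)
Definition tilt p u x := inf [set p (x + t *: u) - t * p u | t in [set t | 0 <= t]].

Lemma tilt_has_inf p u x : sublinear p ->
  has_inf [set p (x + t *: u) - t * p u | t in [set t | 0 <= t]].
Proof.
move=> [p0 pD pZ]; split; first by exists (p (x + 0 *: u) - 0 * p u), 0 => /=.
(* Subadditivity at [x + t *: u] and [- x], whose sum is [t *: u], gives a lower bound independent
   of t. *)
exists (- p (- x)) => _ [t /= t0 <-].
have ptu : p (t *: u) = t * p u.
  by move: t0; rewrite le_eqVlt => /predU1P[<-|/pZ//]; rewrite scale0r mul0r.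
by have := pD (x + t *: u) (- x); rewrite addrC addKr ptu; lra.
Qed.

Lemma tilt_le p u x t : sublinear p -> 0 <= t ->
  tilt p u x <= p (x + t *: u) - t * p u.
Proof. by move=> sp t0; apply: ge_inf; [case: (tilt_has_inf u x sp)|exists t]. Qed.

Lemma tilt_sublinear p u : sublinear p -> sublinear (tilt p u).
Proof.
move=> sp; have [p0 pD pZ] := sp.
have pZ0 a x : 0 <= a -> p (a *: x) = a * p x.
  by rewrite le_eqVlt => /predU1P[<-|/pZ//]; rewrite scale0r p0 mul0r.
split=> [|x y|a x a0].
- apply/le_anti/andP; split.
    by rewrite (le_trans (tilt_le _ _ sp (lexx 0)))// scale0r add0r p0 mul0r subr0.
  apply: lb_le_inf; first by case: (tilt_has_inf u 0 sp).
  by move=> _ [t /= t0 <-]; rewrite add0r pZ0// subrr.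
- apply/ler_addgt0Pr => e e0; have e2 : 0 < e / 2 by rewrite divr_gt0.
  have [_ [s /= s0 <-] hs] := inf_adherent e2 (tilt_has_inf u x sp).
  have [_ [t /= t0 <-] ht] := inf_adherent e2 (tilt_has_inf u y sp).
  rewrite (le_trans (tilt_le _ _ sp (addr_ge0 s0 t0)))//.
  have := pD (x + s *: u) (y + t *: u); rewrite addrACA -scalerDl.
  by move: hs ht; rewrite -/(tilt p u x) -/(tilt p u y); lra.
- apply/le_anti/andP; split.
    rewrite -ler_pdivrMl//; apply: lb_le_inf.
      by case: (tilt_has_inf u x sp).
    move=> _ [t /= t0 <-]; rewrite ler_pdivrMl//.
    rewrite (le_trans (tilt_le _ _ sp (mulr_ge0 (ltW a0) t0)))//.
    by rewrite -scalerA -scalerDr pZ// mulrBr mulrA.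
  apply: lb_le_inf; first by case: (tilt_has_inf u (a *: x) sp).
  move=> _ [t /= t0 <-].
  have -> : a *: x + t *: u = a *: (x + (a^-1 * t) *: u).
    by rewrite scalerDr scalerA mulrA divff ?mul1r// gt_eqF.
  rewrite pZ// -[t in t * p u](mulVKf (lt0r_neq0 a0))// -mulrA -mulrBr ler_pM2l//.
  by apply: tilt_le => //; rewrite mulr_ge0// invr_ge0 ltW.
Qed.

Lemma tilt_leq p u x : sublinear p -> tilt p u x <= p x.
Proof.
by move=> sp; have := tilt_le u x sp (lexx 0); rewrite scale0r addr0 mul0r subr0.
Qed.

(** Zorn's lemma for the reversed pointwise order. A nonempty chain is bounded by its pointwise
    infimum, finite because every sublinear [q <= p] satisfies [q x >= - p (- x)]; the empty chain
    is bounded by [p]. *)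
Lemma minimal_sublinear p : sublinear p -> exists q,
  [/\ sublinear q, forall x, q x <= p x &
      forall r, sublinear r -> (forall x, r x <= q x) -> r = q].
Proof.
move=> sp; pose T := {q : V -> R | sublinear q /\ forall x, q x <= p x}.
pose le (q r : T) := `[< forall x, sval r x <= sval q x >].
have [| | |A totA|[q [sq qp]] qmin] := @Zorn T le.
- by move=> q; apply/asboolP => x.
- move=> q r s /asboolP qr /asboolP rs; apply/asboolP => x.
  exact: le_trans (qr x).
- move=> [q hq] [r hr] /asboolP qr /asboolP rq; apply: eq_exist.
  by apply/funext => x; apply/le_anti; rewrite qr rq.
- have [->|/set0P[q0 Aq0]] := eqVneq A set0.
    by exists (exist _ p (conj sp (fun x => lexx _))).
  pose B x := [set sval q x | q in A].
  have Blb x : has_inf (B x).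
    split; first by exists (sval q0 x), q0.
    exists (- p (- x)) => _ [[q [sq qp]] Aq <-] /=.
    by rewrite (le_trans _ (sublinear_ge x sq))// lerN2.
  have Ble (q : T) x : A q -> inf (B x) <= sval q x.
    by move=> Aq; apply: ge_inf; [case: (Blb x)|exists q].
  have sB : sublinear (fun x => inf (B x)).
    split=> [|x y|a x a0].
    + rewrite (_ : B 0 = [set 0]) ?inf1//.
      apply/seteqP; split=> [_ [[q [[q00 qD qZ] qp]] Aq <-]//|_ ->].
      by exists q0 => //; case: (svalP q0) => [[]].
    + apply/ler_addgt0Pr => e e0; have e2 : 0 < e / 2 by rewrite divr_gt0.
      have [_ [q Aq <-] hq] := inf_adherent e2 (Blb x).
      have [_ [r Ar <-] hr] := inf_adherent e2 (Blb y).
      (* In a chain, the smaller of the two near-minimisers serves at both points, so its own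
         subadditivity passes to the infimum. *)
      have [s [As sq sr]] : exists s, [/\ A s, sval s x <= sval q x &
          sval s y <= sval r y].
        by case: (totA _ _ Aq Ar) => /asboolP h; [exists r|exists q].
      have := Ble s (x + y) As; have [[_ sD _] _] := svalP s.
      by have := sD x y; lra.
    + apply/le_anti/andP; split.
        rewrite -ler_pdivrMl//; apply: lb_le_inf; first by case: (Blb x).
        move=> _ [q Aq <-]; rewrite ler_pdivrMl//.
        have [[_ _ <-//] _] := svalP q; exact: Ble.
      apply: lb_le_inf; first by case: (Blb (a *: x)).
      move=> _ [q Aq <-]; have [[_ _ ->//] _] := svalP q.
      by rewrite ler_pM2l//; exact: Ble.
  have Bp x : inf (B x) <= p x.
    by rewrite (le_trans (Ble q0 x Aq0))//; case: (svalP q0).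
  by exists (exist _ (fun x => inf (B x)) (conj sB Bp)) => q Aq; apply/asboolP => x; exact: Ble.
exists q; split=> // r sr rq.
have rp x : r x <= p x by rewrite (le_trans (rq x)).
pose r' : T := exist _ r (conj sr rp).
have qr' : le (exist _ q (conj sq qp)) r' by apply/asboolP.
by have /(congr1 (fun t : T => sval t)) := qmin r' qr'.
Qed.

(* A minimal sublinear functional coincides with its tilts, which makes it
   superadditive, hence linear. *)
Lemma sublinear_linear_minorant p : sublinear p ->
  exists f : {scalar V}, forall x, f x <= p x.
Proof.
move=> sp; have [q [sq qp qmin]] := minimal_sublinear sp.
have [q0 qD qZ] := sq.
have addq x y : q (x + y) = q x + q y.
  apply/le_anti; rewrite qD/=.
  have := tilt_le y x sq (@ler01 R); rewrite scale1r mul1r.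
  rewrite (qmin (tilt q y) (tilt_sublinear y sq)); first by lra.
  by move=> z; exact: tilt_leq.
have oppq x : q (- x) = - q x.
  by apply/eqP; rewrite -addr_eq0 -addq addNr q0.
have lq : linear_for *%R q.
  move=> a x y; rewrite addq; congr (_ + _).
  have [a0|a0|->] := ltrgt0P a; last by rewrite scale0r q0 mul0r.
    exact: qZ.
  by apply: oppr_inj; rewrite -oppq -scaleNr qZ ?oppr_gt0// mulNr.
by exists (linear_of lq).
Qed.

Definition seminorm p := [/\ forall x, 0 <= p x,
  forall x y, p (x + y) <= p x + p y & forall a x, p (a *: x) = `|a| * p x].

(** A linear minorant of [tilt p u] rather than of [p] is taken: lying below the tilt forces
    equality at [u], and the symmetry of a seminorm turns the one-sided bound into a bound on the
    absolute value. *)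
Lemma Hahn_Banach p u : seminorm p ->
  exists f : {scalar V}, (forall x, `|f x| <= p x) /\ f u = p u.
Proof.
move=> [p0 pD pZ].
have sp : sublinear p.
  split=> // [|a x a0]; first by rewrite -(scale0r 0) pZ normr0 mul0r.
  by rewrite pZ gtr0_norm.
have [f fp] := sublinear_linear_minorant (tilt_sublinear u sp).
have pN x : p (- x) = p x by rewrite -scaleN1r pZ normrN1 mul1r.
have fp' x : f x <= p x by rewrite (le_trans (fp x))// tilt_leq.
exists f; split=> [x|].
  by rewrite ler_norml fp' andbT lerNl -raddfN -pN fp'.
apply/le_anti; rewrite fp'/= -lerN2 -raddfN (le_trans (fp _))//.
have := tilt_le u (- u) sp (@ler01 R).
by rewrite scale1r mul1r addNr; case: sp => -> _ _; rewrite sub0r.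
Qed.

End HahnBanach.

(** * Bounded maps and duality *)

Section BoundedMaps.
Variables (R : realType) (V W : normedModType R).

Definition bounded_map (f : V -> W) := exists M, forall x, `|f x| <= M * `|x|.

Lemma bounded_map_gt0 f : bounded_map f ->
  exists2 M, 0 < M & forall x, `|f x| <= M * `|x|.
Proof.
move=> [M fM]; exists (`|M| + 1) => [|x]; first by rewrite ltr_wpDl.
rewrite (le_trans (fM x))// ler_wpM2r//.
by rewrite (le_trans (ler_norm M))// lerDl.
Qed.

Lemma continuous_bounded_map (f : {linear V -> W}) :
  continuous f -> bounded_map f.
Proof.
move=> /(_ 0) /continuous_linear_bounded -/(_ 0) /linear_boundedP.
by move=> /pinfty_ex_gt0[M _ fM]; exists M.
Qed.

Lemma bounded_map_continuous (f : V -> W) :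
  {morph f : x y / x - y >-> x - y} -> bounded_map f -> continuous f.
Proof.
move=> fB /bounded_map_gt0[M M0 fM] x.
apply/(@cvgrPdist_lt _ _ _ (nbhs x)) => e e0; near=> z.
rewrite -fB (le_lt_trans (fM _))// -ltr_pdivlMl//.
by near: z; apply: cvgr_dist_lt => //; rewrite mulr_gt0 ?invr_gt0.
Unshelve. all: by end_near. Qed.

End BoundedMaps.

Lemma bounded_map_comp (R : realType) (U V W : normedModType R)
    (f : V -> W) (g : U -> V) :
  bounded_map f -> bounded_map g -> bounded_map (f \o g).
Proof.
move=> /bounded_map_gt0[M M0 fM] /bounded_map_gt0[N N0 gN].
exists (M * N) => x /=; rewrite (le_trans (fM _))// -mulrA ler_wpM2l//.
exact: ltW.
Qed.

Section NormApproximation.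
Variables (R : realType) (V : normedModType R).
Implicit Types (A : set V) (x : V).

Lemma closure_normP A x :
  closure A x <-> forall e, 0 < e -> exists2 a, A a & `|x - a| < e.
Proof.
split=> [+ e e0|h B /nbhs_ballP[e /= e0 eB]].
  move=> /(_ (ball x e)); case; first exact: nbhsx_ballx.
  by move=> a [Aa]; rewrite -ball_normE /=; exists a.
by have [a Aa xa] := h e e0; exists a; split=> //; apply: eB; rewrite -ball_normE.
Qed.

Lemma dense_normP A :
  dense A <-> forall x e, 0 < e -> exists2 a, A a & `|x - a| < e.
Proof.
split=> [dA x e e0|h U [x Ux] oU].
  have [||a [xa Aa]] := dA (ball x e).
  - by exists x; exact: ballxx.
  - exact: ball_open.
  - by exists a => //; move: xa; rewrite -ball_normE.
have /nbhs_ballP[e /= e0 eU] : nbhs x U by exact: open_nbhs_nbhs.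
by have [a Aa xa] := h x e e0; exists a; split=> //; apply: eU; rewrite -ball_normE.
Qed.

Lemma closed_normP A :
  (forall x, (forall e, 0 < e -> exists2 a, A a & `|x - a| < e) -> A x) ->
  closed A.
Proof. by move=> h x /closure_normP; exact: h. Qed.

End NormApproximation.

(** * Consequences of Hahn-Banach in normed spaces *)

Section Duality.
Variables (R : realType) (E : normedModType R).

Lemma norming_functional (x : E) : exists f : {scalar E},
  (forall y, `|f y| <= `|y|) /\ f x = `|x|.
Proof.
apply: (@Hahn_Banach R E (fun y => `|y|) x).
by split=> [y|y z|a y]; [|exact: ler_normD|exact: normrZ].
Qed.

Lemma quotient_pi_eq0 (X : closedSubspace E) (x : E) :
  quotient_pi X x = 0 <-> (X : set E) x.
Proof.
by rewrite -(raddf0 (quotient_pi X)); split=> [/quotient_pi_eq|xX];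
  [|apply/quotient_pi_eq]; rewrite subr0.
Qed.

Lemma closedSubspace_separation (X : closedSubspace E) (x : E) :
  ~ (X : set E) x -> exists f : {scalar E},
  [/\ bounded_map f, forall y, (X : set E) y -> f y = 0 & f x != 0].
Proof.
move=> nXx; have [f [fle fx]] : exists f : {scalar quotient_space X},
    (forall y, `|f y| <= `|y|) /\ f (quotient_pi X x) = `|quotient_pi X x|.
  apply: (@Hahn_Banach R (quotient_space X) (fun y => `|y|) (quotient_pi X x)).
  by split=> [y|y z|a y]; [|exact: ler_normD|exact: normrZ].
exists (f \o quotient_pi X : {scalar E}); split=> /=.
- exists 1 => y; rewrite mul1r (le_trans (fle _))//; exact: ler_quotient_pi.
- by move=> y /quotient_pi_eq0 ->; rewrite raddf0.
- by rewrite fx normr_eq0; apply/eqP => /quotient_pi_eq0.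
Qed.

(** The closure of [A] is a closed subspace; a point outside it would be separated from it by a
    bounded functional vanishing on [A]. *)
Lemma submod_dense (A : set E) :
  A 0 -> (forall a x y, A x -> A y -> A (a *: x + y)) ->
  (forall f : {scalar E}, bounded_map f -> (forall x, A x -> f x = 0) ->
    forall x, f x = 0) ->
  dense A.
Proof.
move=> A0 AD h.
have sub : submod_closed [pred x | x \in closure A].
  split; first by rewrite inE; exact: subset_closure.
  move=> a x y; rewrite !inE => /closure_normP cx /closure_normP cy.
  apply/closure_normP => e e0.
  have a0 : 0 < `|a| + 1 by rewrite ltr_wpDl.
  have [x' Ax' xx'] := cx (e / 2 / (`|a| + 1)) ltac:(by rewrite !divr_gt0).
  have [y' Ay' yy'] := cy (e / 2) ltac:(by rewrite divr_gt0).
  exists (a *: x' + y'); first exact: AD.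
  rewrite opprD addrACA -scalerBr (le_lt_trans (ler_normD _ _))//.
  rewrite [e]splitr ler_ltD// normrZ (@le_trans _ _ ((`|a| + 1) * `|x - x'|))//.
    by rewrite ler_wpM2r// lerDl.
  by rewrite mulrC -ler_pdivlMr// ltW.
pose X := ClosedSubspace sub (@closed_closure _ A).
apply/dense_normP => x; apply/closure_normP; apply: contrapT => nX.
have [f [fb fX]] := @closedSubspace_separation X x nX.
by rewrite h ?eqxx// => y Ay; apply: fX; exact: subset_closure.
Qed.

End Duality.

Lemma cvg_geometric_bound (R : realType) (E : completeNormedModType R)
    (v : nat -> E) (C : R) :
  (forall n, `|v n| <= C * 2^-1 ^+ n) -> cvgn (series v).
Proof.
move=> vC; apply: normed_cvg.
apply: (@series_le_cvg _ _ (geometric C 2^-1)) => //.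
- by move=> n /=.
- by move=> n; exact: le_trans (normr_ge0 _) (vC n).
- by apply: is_cvg_geometric_series; rewrite ger0_norm// invf_lt1// ltr1n.
Qed.

Lemma half_pow_small (R : realType) (C e : R) : 0 < e ->
  \forall n \near \oo, C * 2^-1 ^+ n < e.
Proof.
move=> e0.
have : C * 2^-1 ^+ n @[n --> \oo] --> C * 0.
  apply: cvgMr; apply: cvg_expr.
  by rewrite ger0_norm// invf_lt1// ltr1n.
by rewrite mulr0 => /cvgr_lt; apply.
Qed.

(** * Surjectivity criteria for bounded operators *)

Section Surjectivity.
Variables (R : realType) (G : completeNormedModType R) (F : normedModType R).
Variable A : {linear G -> F}.

(** Successive approximation: the residuals [w n] halve at each step, so the corrections [s (w n)]
    form a geometrically bounded series, whose sum in the complete space [G] is a preimage. *)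
Lemma surjective_of_approximation (M : R) : bounded_map A ->
  (forall u, exists g, `|u - A g| <= 2^-1 * `|u| /\ `|g| <= M * `|u|) ->
  range A = setT.
Proof.
move=> bA /choice[s sP]; apply/seteqP; split=> // u _.
pose w := fun n => iter n (fun x => x - A (s x)) u.
have wn n : `|w n| <= `|u| * 2^-1 ^+ n.
  elim: n => [|n ih]; first by rewrite expr0 mulr1.
  have [+ _] := sP (w n); move=> /le_trans; apply.
  by rewrite exprS mulrCA ler_wpM2l// invr_ge0.
(* The sign of [M] is not prescribed, but a negative [M] is compatible with the estimate on [s u]
   only when u = 0. *)
have M0 : 0 <= M \/ u = 0.
  have [->|u0] := eqVneq u 0; [by right|left].
  have [_ h] := sP u; have := le_trans (normr_ge0 _) h.
  by rewrite pmulr_lge0// normr_gt0.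
have cs : cvgn (series (s \o w)).
  apply: (@cvg_geometric_bound _ _ _ (M * `|u|)) => n /=.
  have [_ +] := sP (w n); move=> /le_trans; apply.
  case: M0 => [M0|u0]; first by rewrite -mulrA ler_wpM2l.
  by have := wn n; rewrite u0 normr0 mul0r normr_le0 => /eqP ->; rewrite normr0 !mulr0 mul0r.
have Aw n : A (series (s \o w) n) = u - w n.
  elim: n => [|n ih]; first by rewrite /series /= big_geq// raddf0 subrr.
  by rewrite seriesSr/= raddfD/= ih opprB -addrA (addrC (- _)).
exists (limn (series (s \o w))); first by [].
have : A (series (s \o w) n) @[n --> \oo] --> A (limn (series (s \o w))).
  apply: continuous_cvg => //; apply: bounded_map_continuous => //.
  exact: raddfB.
move=> /cvg_lim <- //; apply/cvg_lim => //.
apply/cvgrPdist_lt => e e0; have := half_pow_small `|u| e0.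
by apply: filterS => n; rewrite Aw opprB addrC subrK; exact: le_lt_trans.
Qed.

(* Hahn-Banach for the seminorm x |-> inf_g (K |x - A g| + |g|), with K large,
   gives the approximate solutions of A g = u that are then iterated. *)
Lemma surjective_of_dual_bound (M : R) : bounded_map A ->
  (forall f : {scalar F}, bounded_map f -> (forall g, `|f (A g)| <= `|g|) ->
    forall u, `|f u| <= M * `|u|) ->
  range A = setT.
Proof.
(* [N] exceeds [M], so some g brings the quantity under the infimum below [N * |u|]; with K = 2N
   this forces [|u - A g| <= |u| / 2]. *)
move=> bA hM; pose N := `|M| + 1; pose K := N * 2.
have N0 : 0 < N by rewrite ltr_wpDl.
have K0 : 0 < K by rewrite mulr_gt0.
pose S x := [set K * `|x - A g| + `|g| | g in [set: G]].
pose p x := inf (S x).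
have Si x : has_inf (S x).
  split; first by exists (K * `|x - A 0| + `|0 : G|), 0.
  by exists 0 => _ [g _ <-]; rewrite addr_ge0// mulr_ge0// ltW.
have pS x g : p x <= K * `|x - A g| + `|g|.
  by apply: ge_inf; [case: (Si x)|exists g].
have p0 x : 0 <= p x.
  apply: lb_le_inf; first by case: (Si x).
  by move=> _ [g _ <-]; rewrite addr_ge0// mulr_ge0// ltW.
have pD x y : p (x + y) <= p x + p y.
  apply/ler_addgt0Pr => e e0; have e2 : 0 < e / 2 by rewrite divr_gt0.
  have [_ [g _ <-] hg] := inf_adherent e2 (Si x).
  have [_ [h _ <-] hh] := inf_adherent e2 (Si y).
  rewrite (le_trans (pS _ (g + h)))// raddfD opprD addrACA.
  have /(ler_wpM2l (ltW K0)) := ler_normD (x - A g) (y - A h).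
  have := ler_normD g h; move: hg hh; rewrite -/(p x) -/(p y); lra.
have pZ_le a x : p (a *: x) <= `|a| * p x.
  have [->|a0] := eqVneq a 0.
    by rewrite scale0r normr0 mul0r (le_trans (pS _ 0))// raddf0 subrr !normr0 mulr0 addr0.
  rewrite -ler_pdivrMl ?normr_gt0//; apply: lb_le_inf; first by case: (Si x).
  move=> _ [g _ <-]; rewrite ler_pdivrMl ?normr_gt0//.
  by rewrite (le_trans (pS _ (a *: g)))// linearZ/= -scalerBr !normrZ mulrDr mulrCA.
have pZ a x : p (a *: x) = `|a| * p x.
  apply/le_anti; rewrite pZ_le/=.
  have [->|a0] := eqVneq a 0; first by rewrite normr0 mul0r.
  rewrite -ler_pdivlMl ?normr_gt0// -normfV.
  by rewrite -{1}[x](scalerK a0) pZ_le.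
(* A functional dominated by [p] is bounded by [K] (take g = 0) and contracts along [A] (take x = A
   g), so the dual hypothesis applies to the one that attains [p u]. *)
have pM u : p u <= M * `|u|.
  have [f [fp fu]] := Hahn_Banach u (And3 p0 pD pZ).
  rewrite -fu (le_trans (ler_norm _))//; apply: hM => [|g].
    exists K => x; rewrite (le_trans (fp x))// (le_trans (pS x 0))//.
    by rewrite raddf0 subr0 normr0 addr0.
  by rewrite (le_trans (fp _))// (le_trans (pS _ g))// subrr normr0 mulr0 add0r.
apply: (@surjective_of_approximation N) => // u.
have [->|u0] := eqVneq u 0.
  by exists 0; rewrite raddf0 subrr !normr0 !mulr0.
have nu : 0 < `|u| by rewrite normr_gt0.
have [_ [g _ <-]] := inf_adherent nu (Si u).
rewrite -/(p u) => hg; exists g.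
have {}hg : K * `|u - A g| + `|g| < N * `|u|.
  rewrite (lt_le_trans hg)// mulrDl mul1r lerD2r (le_trans (pM u))//.
  by rewrite ler_wpM2r// ler_norm.
split.
  rewrite ler_pdivlMl// -(ler_pM2l N0) mulrA ltW// (le_lt_trans _ hg)//.
  by rewrite lerDl.
by rewrite ltW// (le_lt_trans _ hg)// lerDr mulr_ge0// ltW.
Qed.

End Surjectivity.

(** * Biorthogonal systems adapted to an operator range *)

(** Dependent choice in which each term may depend on all earlier ones. The first hypothesis says
    that [P n] reads only the entries below n, so the finite lists built so far, padded by [t0],
    determine the next choice. *)
Lemma course_of_values_choice (T : Type) (t0 : T)
    (P : nat -> (nat -> T) -> T -> Prop) :
  (forall n f g t, (forall k, (k < n)%N -> f k = g k) -> P n f t -> P n g t) ->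
  (forall n f, (forall k, (k < n)%N -> P k f (f k)) -> exists t, P n f t) ->
  exists f, forall n, P n f (f n).
Proof.
move=> ext step.
have /choice[F FP] (nf : nat * (nat -> T)) : exists t,
    (forall k, (k < nf.1)%N -> P k nf.2 (nf.2 k)) -> P nf.1 nf.2 t.
  have [/step[t Pt]|nP] := pselect (forall k, (k < nf.1)%N -> P k nf.2 (nf.2 k)).
    by exists t.
  by exists t0 => /nP.
pose s := fix s n := if n is m.+1 then rcons (s m) (F (m, nth t0 (s m))) else [::].
have size_s n : size (s n) = n by elim: n => //= n ih; rewrite size_rcons ih.
pose f n := F (n, nth t0 (s n)).
have sf n k : (k < n)%N -> nth t0 (s n) k = f k.
  elim: n => // n ih; rewrite ltnS leq_eqVlt /= nth_rcons size_s => /predU1P[->|kn].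
    by rewrite ltnn eqxx.
  by rewrite kn ih.
exists f; elim/ltn_ind => n ih.
apply: (ext n (nth t0 (s n))) => [k|]; first exact: sf.
apply: (FP (n, nth t0 (s n))) => k /= kn.
rewrite sf//; apply: (ext k f) (ih k kn) => j jk.
by rewrite sf// (ltn_trans jk).
Qed.

Section Biorthogonal.
Variables (R : realType) (G : completeNormedModType R) (F : normedModType R).
Variable A : {linear G -> F}.
Hypotheses (bA : bounded_map A) (dA : dense (range A)) (nA : range A <> setT).

(** If no such pair existed, every bounded functional contracting along [A] would be bounded by [M]
    on the dense range, hence everywhere, and the dual criterion would make [A] onto. *)
Lemma steep_functional (M : R) : 0 <= M -> exists f : {scalar F}, exists g,
  [/\ bounded_map f, forall h, `|f (A h)| <= `|h| & M * `|A g| < `|f (A g)|].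
Proof.
move=> M0; apply: contrapT => nf; apply: nA.
apply: (@surjective_of_dual_bound _ _ _ A M bA) => f bf fA u.
rewrite leNgt; apply/negP => Mu; apply: nf; exists f.
have [B B0 fB] := bounded_map_gt0 bf.
have BM0 : 0 < B + M by rewrite ltr_wpDr.
(* Replacing [u] by [A g] changes the two sides by at most [B] and [M] times [|u - A g|], so this
   tolerance keeps the inequality strict. *)
have e0 : 0 < (`|f u| - M * `|u|) / (B + M) by rewrite divr_gt0 ?subr_gt0.
have [_ [g _ <-]] := (dense_normP _).1 dA u _ e0.
rewrite ltr_pdivlMr// => hg; exists g; split=> //.
have := fB (u - A g); rewrite raddfB/= => h1.
have := ler_normD (f u - f (A g)) (f (A g)); rewrite subrK => h2.
have := ler_normD u (A g - u); rewrite addrC subrK => h3.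
have := ler_wpM2l M0 h3; rewrite (distrC (A g)) mulrDr => h4.
move: hg; rewrite mulrDr !(mulrC `|u - A g|); lra.
Qed.

(** One step of the gliding hump. The projection [e] onto the common kernel of the earlier
    functionals kills the earlier vectors; a steep functional composed with [e] and scaled by
    [r / K] is the new functional, and its steepness must absorb the norms lost in projecting and
    scaling. *)
Lemma biorthogonal_step (n : nat) (r : R) (f : nat -> G * {scalar F}) : 0 < r ->
  (forall i j, (i < n)%N -> (j < n)%N -> (f i).2 (A (f j).1) = (i == j)%:R) ->
  (forall i, (i < n)%N -> bounded_map (f i).2) ->
  (forall i, (i < n)%N -> exists C, forall g, `|(f i).2 (A g)| <= C * `|g|) ->
  exists t : G * {scalar F},
  [/\ t.2 (A t.1) = 1,
      forall k, (k < n)%N -> t.2 (A (f k).1) = 0 /\ (f k).2 (A t.1) = 0,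
      bounded_map t.2,
      `|A t.1| <= 1 &
      forall g, `|t.2 (A g)| <= r * `|g|].
Proof.
move=> r0 fij fb fA.
have /choice[b bP] i : exists c, 0 <= c /\
    ((i < n)%N -> forall x, `|(f i).2 x| <= c * `|x|).
  have [ni|ni] := ltnP i n; last by exists 0; split.
  by have [c /ltW c0 h] := bounded_map_gt0 (fb i ni); exists c.
have /choice[c cP] i : exists c, 0 <= c /\
    ((i < n)%N -> forall g, `|(f i).2 (A g)| <= c * `|g|).
  have [ni|ni] := ltnP i n; last by exists 0; split.
  have [c h] := fA i ni; exists `|c|; split=> // _ g.
  by rewrite (le_trans (h g))// ler_wpM2r// ler_norm.
pose e x := x - \sum_(i < n) (f i).2 x *: A (f i).1.
have le : linear e.
  move=> a x y; rewrite /e scalerBr scaler_sumr [RHS]addrACA -opprD -big_split/=.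
  congr (_ - _); apply: eq_bigr => i _.
  by rewrite linearP/= scalerDl scalerA.
pose e' : {linear F -> F} := linear_of le.
have fe k x : (k < n)%N -> (f k).2 (e x) = 0.
  move=> kn; rewrite /e raddfB raddf_sum/= (bigD1 (Ordinal kn))//= big1.
    by rewrite linearZ/= fij// eqxx mulr1 addr0 subrr.
  move=> i ik; rewrite linearZ/= fij//.
  rewrite (_ : (k == i) = false) ?mulr0//.
  by apply: contra_neqF ik => /eqP ki; apply: val_inj.
have eA k : (k < n)%N -> e (A (f k).1) = 0.
  move=> kn; rewrite /e (bigD1 (Ordinal kn))//= big1.
    by rewrite fij// eqxx scale1r addr0 subrr.
  move=> i ik; rewrite fij//.
  rewrite (_ : (i == k :> nat) = false) ?scale0r//.
  by apply: contra_neqF ik => /eqP ki; apply: val_inj.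
(* The lift of [e] to [G]: it lets bounds along [A] and the new vector itself be computed
   upstairs. *)
pose d g := g - \sum_(i < n) (f i).2 (A g) *: (f i).1.
have Ad g : A (d g) = e (A g).
  by rewrite /e /d raddfB raddf_sum/=; congr (_ - _); apply: eq_bigr => i _; rewrite linearZ.
(* [K] bounds [d], [N] bounds [e], and [L] bounds [psi] on [x - e x]. Steepness [L + K * N / r] thus
   leaves [|psi (A (d g))|] above [K / r * |A (d g)|]. *)
pose K := 1 + \sum_(i < n) c i * `|(f i).1|.
pose L := \sum_(i < n) b i * `|(f i).1|.
pose N := 1 + \sum_(i < n) b i * `|A (f i).1|.
have K0 : 0 < K.
  by rewrite ltr_wpDr// sumr_ge0// => i _; rewrite mulr_ge0//; case: (cP i).
have N0 : 0 < N.
  by rewrite ltr_wpDr// sumr_ge0// => i _; rewrite mulr_ge0//; case: (bP i).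
have dK g : `|d g| <= K * `|g|.
  rewrite /d (le_trans (ler_normB _ _))// /K mulrDl mul1r lerD2l.
  rewrite (le_trans (ler_norm_sum _ _ _))// mulr_suml ler_sum// => i _.
  by rewrite normrZ mulrAC ler_wpM2r//; have [_ ->] := cP i.
have eN x : `|e x| <= N * `|x|.
  rewrite /e (le_trans (ler_normB _ _))// /N mulrDl mul1r lerD2l.
  rewrite (le_trans (ler_norm_sum _ _ _))// mulr_suml ler_sum// => i _.
  by rewrite normrZ mulrAC ler_wpM2r//; have [_ ->] := bP i.
have LKN0 : 0 <= L + K * N / r.
  apply: addr_ge0; last by rewrite divr_ge0 ?mulr_ge0 ?ltW.
  by apply: sumr_ge0 => i _; rewrite mulr_ge0//; case: (bP i).
have [psi [g [psiB psiA psig]]] := steep_functional LKN0.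
have psiL x : `|psi (x - e x)| <= L * `|x|.
  rewrite /e opprB addrC subrK raddf_sum/= /L mulr_suml.
  rewrite (le_trans (ler_norm_sum _ _ _))// ler_sum// => i _.
  rewrite linearZ/= normrM mulrAC ler_pM//; have [_ -> //] := bP i.
have ltheta : linear_for *%R (fun x => r / K * psi (e x)).
  by move=> a x y; rewrite le linearP/= mulrDr mulrCA.
pose theta : {scalar F} := linear_of ltheta.
have rK0 : 0 < r / K by rewrite divr_gt0.
have vlt : `|A (d g)| < `|theta (A (d g))|.
  have ee : e (A (d g)) = A (d g).
    by rewrite {1}/e big1 ?subr0// => i _; rewrite Ad fe// scale0r.
  rewrite /theta/= ee normrM gtr0_norm// -ltr_pdivrMl// invf_div.
  have := psiL (A g); rewrite -Ad raddfB/= => h1.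
  have := ler_normD (psi (A g) - psi (A (d g))) (psi (A (d g))).
  rewrite subrK => h2.
  have := ler_wpM2l (ltW (divr_gt0 K0 r0)) (eN (A g)); rewrite -Ad => h3.
  move: psig; rewrite mulrDl.
  have -> : K * N / r = K / r * N by rewrite mulrAC.
  rewrite mulrA in h3; lra.
have v0 : theta (A (d g)) != 0 by rewrite -normr_gt0 (le_lt_trans _ vlt).
exists ((theta (A (d g)))^-1 *: d g, theta); split=> [|k kn|||h].
- by rewrite !linearZ/= mulVf.
- split; first by rewrite /= eA// raddf0 mulr0.
  by rewrite !linearZ/= Ad fe// mulr0.
- have [C psiC] : bounded_map (psi \o e).
    by apply: bounded_map_comp => //; exists N.
  exists (r / K * C) => x; rewrite /= normrM gtr0_norm// -[leRHS]mulrA ler_pM2l//.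
  exact: psiC.
- rewrite linearZ/= normrZ normfV mulrC ler_pdivrMr ?normr_gt0// mul1r.
  exact: ltW.
- rewrite /= normrM gtr0_norm// -Ad -mulrA ler_pM2l// ler_pdivrMl//.
  by rewrite (le_trans (psiA _)).
Qed.

Lemma biorthogonal_system (rho : nat -> R) : (forall n, 0 < rho n) ->
  exists (g : nat -> G) (th : nat -> {scalar F}),
  [/\ forall i j, th i (A (g j)) = (i == j)%:R,
      forall n, bounded_map (th n),
      forall n, `|A (g n)| <= 1 &
      forall n h, `|th n (A h)| <= rho n * `|h|].
Proof.
move=> rho0.
have lin0 : linear_for *%R (fun _ : F => 0 : R).
  by move=> a x y; rewrite mulr0 addr0.
pose P n (f : nat -> G * {scalar F}) (t : G * {scalar F}) :=
  [/\ t.2 (A t.1) = 1,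
      forall k, (k < n)%N -> t.2 (A (f k).1) = 0 /\ (f k).2 (A t.1) = 0,
      bounded_map t.2,
      `|A t.1| <= 1 &
      forall g, `|t.2 (A g)| <= rho n * `|g|].
have biorth n f : (forall k, (k < n)%N -> P k f (f k)) ->
    forall i j, (i < n)%N -> (j < n)%N -> (f i).2 (A (f j).1) = (i == j)%:R.
  move=> fP i j ni nj; have [ij|ji|<-] := ltngtP i j.
  - by have [_ /(_ i ij)[]] := fP j nj.
  - by have [_ /(_ j ji)[]] := fP i ni.
  - by have [] := fP i ni.
have [||f fP] := @course_of_values_choice _ (0, linear_of lin0) P.
- move=> n f g t fg [t1 t2 t3 t4 t5]; split=> // k kn.
  by rewrite -fg//; exact: t2.
- move=> n f fP; apply: biorthogonal_step => // [|i ni|i ni].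
  + exact: biorth.
  + by have [] := fP i ni.
  + by exists (rho i); have [] := fP i ni.
exists (fun n => (f n).1), (fun n => (f n).2); split=> [i j|n|n|n].
- apply: (@biorth (maxn i j).+1); rewrite ?ltnS ?leq_maxl ?leq_maxr//.
- by have [] := fP n.
- by have [] := fP n.
- by have [] := fP n.
Qed.

End Biorthogonal.

(** * Operator ranges of bounded orbits *)

Definition bounded_orbit (R : realType) (E : normedModType R)
  (f : nat -> {scalar E}) : set E := [set x | exists C, forall n, `|f n x| <= C].

Definition bounded_orbit_pred (R : realType) (E : normedModType R)
  (f : nat -> {scalar E}) : {pred E} := [pred x | x \in bounded_orbit f].

Lemma bounded_orbit_submod (R : realType) (E : normedModType R)
  (f : nat -> {scalar E}) : submod_closed (bounded_orbit_pred f).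
Proof.
split=> [|a x y]; rewrite !inE.
  by exists 0 => n; rewrite raddf0 normr0.
move=> [C xC] [D yD]; exists (`|a| * C + D) => n.
rewrite linearP/= (le_trans (ler_normD _ _))// normrM.
by rewrite lerD// ler_wpM2l.
Qed.

HB.instance Definition _ (R : realType) (E : normedModType R)
    (f : nat -> {scalar E}) :=
  GRing.isSubmodClosed.Build R E (bounded_orbit_pred f)
    (bounded_orbit_submod f).

(** The boundedness proof is a parameter of the type so that the completeness instance, which relies
    on it, can be inferred from the type alone. *)
Record orbit_space (R : realType) (E : normedModType R)
  (f : nat -> {scalar E}) (bf : forall n, bounded_map (f n)) := OrbitSpace {
  orbit_val :> E;
  orbit_valP : orbit_val \in bounded_orbit_pred f }.

Section OrbitSpace.
Variables (R : realType) (E : normedModType R).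
Variables (f : nat -> {scalar E}) (bf : forall n, bounded_map (f n)).
Notation G := (orbit_space bf).

HB.instance Definition _ := [isSub of G for @orbit_val R E f bf].
HB.instance Definition _ := [Choice of G by <:].
HB.instance Definition _ := [SubChoice_isSubLmodule of G by <:].

(** The graph norm of the map sending x to the bounded sequence of the [f n x]. It makes the
    inclusion into [E] a contraction with image the bounded orbits. *)
Definition orbit_norm (x : G) : R :=
  `|val x| + sup [set `|f n (val x)| | n in [set: nat]].

Let orbit_has_sup (x : G) : has_sup [set `|f n (val x)| | n in [set: nat]].
Proof.
split; first by exists `|f 0%N (val x)|, 0%N.
have := valP x; rewrite inE => -[C xC].
by exists C => _ [n _ <-].
Qed.

Let sup_ge (x : G) n : `|f n (val x)| <= sup [set `|f n (val x)| | n in [set: nat]].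
Proof. by apply: ub_le_sup; [case: (orbit_has_sup x)|exists n]. Qed.

Let sup_le (x : G) C : (forall n, `|f n (val x)| <= C) ->
  sup [set `|f n (val x)| | n in [set: nat]] <= C.
Proof. by move=> h; apply: ge_sup; [case: (orbit_has_sup x)|move=> _ [n _ <-]]. Qed.

Lemma orbit_normP (x : G) C :
  (forall n, `|val x| + `|f n (val x)| <= C) <-> orbit_norm x <= C.
Proof.
split=> [h|h n].
  by rewrite /orbit_norm -lerBrDl sup_le// => n; rewrite lerBrDl.
by rewrite (le_trans _ h)// lerD2l sup_ge.
Qed.

Let normD (x y : G) : orbit_norm (x + y) <= orbit_norm x + orbit_norm y.
Proof.
apply/orbit_normP => n; rewrite raddfD/= raddfD/=.
have := ler_normD (val x) (val y); have := ler_normD (f n (val x)) (f n (val y)).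
have /orbit_normP/(_ n) := lexx (orbit_norm x).
have /orbit_normP/(_ n) := lexx (orbit_norm y).
by rewrite /=; lra.
Qed.

Let normZ_le a (x : G) : orbit_norm (a *: x) <= `|a| * orbit_norm x.
Proof.
apply/orbit_normP => n; rewrite linearZ/= linearZ/= normrZ normrM -mulrDr.
by rewrite ler_wpM2l//; have /orbit_normP := lexx (orbit_norm x); exact.
Qed.

Let norm_ge0 (x : G) : 0 <= orbit_norm x.
Proof.
have /orbit_normP/(_ 0%N) := lexx (orbit_norm x).
by apply: le_trans; rewrite addr_ge0.
Qed.

Let normZ a (x : G) : orbit_norm (a *: x) = `|a| * orbit_norm x.
Proof.
apply/le_anti; rewrite normZ_le/=.
have [->|a0] := eqVneq a 0; first by rewrite normr0 mul0r.
rewrite -ler_pdivlMl ?normr_gt0// -normfV.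
by rewrite -{1}[x](scalerK a0) normZ_le.
Qed.

Let norm0_eq0 (x : G) : orbit_norm x = 0 -> x = 0.
Proof.
move=> x0; apply: val_inj; apply/eqP; rewrite raddf0 -normr_le0 -x0.
have /orbit_normP/(_ 0%N) := lexx (orbit_norm x).
by apply: le_trans; rewrite lerDl.
Qed.

HB.instance Definition _ := Lmodule_isNormed.Build R G normD normZ norm0_eq0.

Lemma le_orbit_norm (x : G) : `|val x| <= `|x|.
Proof.
have /orbit_normP/(_ 0%N) := lexx (orbit_norm x).
by apply: le_trans; rewrite lerDl.
Qed.

End OrbitSpace.

Section OrbitComplete.
Variables (R : realType) (E : completeNormedModType R).
Variables (f : nat -> {scalar E}) (bf : forall n, bounded_map (f n)).
Notation G := (orbit_space bf).

Let orbit_complete (F : set_system G) : ProperFilter F -> cauchy F -> cvg F.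
Proof.
move=> FF /cauchyP cF.
have cl (e : R) : 0 < e -> exists2 p : G, F [set q | `|p - q| < e] & True.
  by move=> /cF[p]; rewrite -ball_normE; exists p.
have : cvg (val @ F).
  apply: cauchy_cvg; apply/cauchyP => e e0.
  have [p Fp _] := cl e e0; exists (val p).
  suff: F [set q | `|val p - val q| < e] by rewrite -ball_normE.
  apply: filterS Fp => q /= pq.
  by apply: le_lt_trans pq; exact: (le_orbit_norm (p - q)).
set l := lim (val @ F) => vl.
(* For each fixed n the Cauchy estimate between p and q passes to the limit of q in [E], by
   continuity of [f n]; the resulting bound does not depend on n. *)
have approx e : 0 < e -> exists2 p : G,
    F [set q | `|p - q| < e] & forall n, `|val p - l| + `|f n (val p - l)| <= e.
  move=> e0; have [p Fp _] := cl e e0; exists p => // n.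
  have [M M0 fM] := bounded_map_gt0 (bf n).
  apply/ler_addgt0Pr => d d0.
  have d2 : 0 < d / (1 + M) by rewrite divr_gt0// addr_gt0.
  have /cvgrPdist_lt/(_ _ d2) Fl := vl.
  have [q [pq ql]] := filter_ex (filterI Fp Fl).
  have {}pq : `|val p - val q| + `|f n (val p - val q)| <= e.
    exact: ((orbit_normP (p - q) e).2 (ltW pq) n).
  have {}ql : `|val q - l| * (1 + M) < d by rewrite -ltr_pdivlMr ?addr_gt0// distrC.
  have h1 := ler_normD (val p - val q) (val q - l).
  have h2 := ler_normD (f n (val p - val q)) (f n (val q - l)).
  have h3 := fM (val q - l).
  move: h1 h2 ql; rewrite -raddfD addrA subrK mulrDr mulr1 (mulrC _ M); lra.
have lP : l \in bounded_orbit_pred f.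
  have [p _ pl] := approx 1 ltr01.
  rewrite inE; have := valP p; rewrite inE => -[C pC].
  exists (1 + C) => n; have := pl n; have := pC n.
  have := ler_normD (f n (l - val p)) (f n (val p)).
  by rewrite -raddfD subrK -opprB raddfN normrN; have := normr_ge0 (val p - l); lra.
apply/cvg_ex; exists (OrbitSpace bf lP).
apply/cvg_ballP => e e0.
have e2 : 0 < e / 2 by rewrite divr_gt0.
have [p Fp pl] := approx _ e2.
apply: filterS Fp => q /= pq; rewrite -ball_normE /= -(subrK p (OrbitSpace _ _)) -addrA.
rewrite (le_lt_trans (ler_normD _ _))// [e]splitr ler_ltD// distrC.
by apply/orbit_normP => n; rewrite raddfB.
Qed.

HB.instance Definition _ := Uniform_isComplete.Build G orbit_complete.

Lemma bounded_orbit_operator_range : operator_range (bounded_orbit f).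
Proof.
exists G, (val : {linear G -> E}); split.
  apply: bounded_map_continuous; first exact: raddfB.
  by exists 1 => x; rewrite mul1r le_orbit_norm.
apply/seteqP; split=> [_ [x _ <-]|x fx]; first by have := valP x; rewrite inE.
have xP : x \in bounded_orbit_pred f by rewrite inE.
by exists (OrbitSpace bf xP).
Qed.

End OrbitComplete.

(** * Finite-rank projections and unbounded sequences of functionals *)

Lemma countable_range (T : countType) (U : Type) (f : T -> U) :
  countable (range f).
Proof. exact: (sub_countable (card_image_le f setT)). Qed.

Lemma countable_enumeration (T : Type) (D : set T) (d0 : T) :
  countable D -> D d0 ->
  exists y : nat -> T, (forall n, D (y n)) /\ forall d, D d -> exists n, y n = d.
Proof.
move=> /countable_injP[i iinj] Dd0.
have /choice[y yP] n : exists d, D d /\ forall d', D d' -> i d' = n -> d = d'.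
  have [[d [Dd <-]]|nd] := pselect (exists d, D d /\ i d = n).
    by exists d; split=> // d' Dd' dd'; apply: iinj; rewrite ?inE.
  by exists d0; split=> // d Dd dn; exfalso; apply: nd; exists d.
exists y; split=> [n|d Dd]; first by have [] := yP n.
by exists (i d); have [_ /(_ d Dd erefl)] := yP (i d).
Qed.

Lemma separable_dense_sequence (R : realType) (V : normedModType R) :
  separable_space V ->
  exists y : nat -> V, forall x e, 0 < e -> exists n, `|x - y n| < e.
Proof.
move=> [D cD /dense_normP dD].
have [d0 Dd0 _] := dD 0 1 ltr01.
have [y [_ yD]] := countable_enumeration cD Dd0.
by exists y => x e /(dD x)[d /yD[n <-]]; exists n.
Qed.

Section FiniteProjection.
Variables (R : realType) (E : lmodType R) (F : set (E -> R)).
Hypothesis Flin : forall f, F f -> linear_for *%R f.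
Hypothesis F0 : F (fun=> 0).
Hypothesis FD : forall a f g, F f -> F g -> F (fun x => f x + a * g x).
Hypothesis Ftotal : forall x, x != 0 -> exists2 f, F f & f x != 0.

(** [F] is abstract because it is used for the bounded functionals and for those approximable on a
    finite set by rational combinations. By induction on [s]: if y is not yet fixed, put u = y - P
    y, pick g in [F] nonzero at u, and add the rank-one term g(x - P x) / g(u) u. Any linear
    functional composed with [P] is then built from finitely many members of [F]. *)
Lemma finite_projection (s : seq E) : exists P : {linear E -> E},
  [/\ forall x, x \in s -> P x = x,
      forall f : {scalar E}, F (f \o P) &
      exists n (v : 'I_n -> E), forall x, exists a : 'I_n -> R,
        P x = \sum_(i < n) a i *: v i].
Proof.
elim: s => [|y s [P [Ps PF [n [v Pv]]]]].
  exists \0; split=> // [f|]; first rewrite (_ : _ \o _ = fun=> 0)//.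
    by apply/funext => x /=; rewrite raddf0.
  exists 0%N, (fun i => 0) => x.
  by exists (fun=> 0); rewrite big_ord0.
pose u := y - P y.
have [u0|u0] := eqVneq u 0.
  exists P; split=> //; last by exists n, v.
  move=> x; rewrite inE => /predU1P[->|/Ps//].
  by apply/esym/eqP; rewrite -subr_eq0 -/u u0.
have [g Fg gu] := Ftotal u0.
pose g' : {scalar E} := linear_of (Flin Fg).
have g0 : g 0 = 0 by exact: (raddf0 g').
have gB x z : g (x - z) = g x - g z by exact: (raddfB g').
pose P' x := P x + (g (x - P x) / g u) *: u.
have lP' : linear P'.
  move=> a x z; rewrite /P' linearP/=.
  have -> : a *: x + z - (a *: P x + P z) = a *: (x - P x) + (z - P z).
    by rewrite opprD addrACA scalerBr.
  by rewrite Flin// mulrDl scalerDl -mulrA -scalerA addrACA -scalerDr.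
have P's x : x \in s -> P' x = x.
  by move=> /Ps xs; rewrite /P' xs subrr g0 mul0r scale0r addr0.
have P'y : P' y = y by rewrite /P' divff// scale1r addrC subrK.
exists (linear_of lP'); split=> [x|f|].
- by rewrite inE => /predU1P[->|] //; exact: P's.
- rewrite (_ : _ \o _ = fun x => (f (P x)) + (f u / g u) * (g x + (-1) * g (P x))).
    by apply: FD; [exact: PF|apply: FD => //; exact: (PF g')].
  apply/funext => x /=; rewrite /P' raddfD/= linearZ/= gB.
  by rewrite mulN1r; congr (_ + _); rewrite mulrC mulrA [RHS]mulrAC.
- exists n.+1, (fun i => if unlift ord0 i is Some j then v j else u) => x.
  have [a Pa] := Pv x.
  exists (fun i => if unlift ord0 i is Some j then a j else g (x - P x) / g u).
  rewrite big_ord_recl unlift_none /= /P' addrC; congr (_ + _).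
  by rewrite Pa; apply: eq_bigr => i _; rewrite liftK.
Qed.

End FiniteProjection.

Lemma scalar_linear (R : realType) (E : lmodType R) (f : {scalar E}) :
  linear_for *%R f.
Proof. by move=> a x y; rewrite linearP. Qed.

Section UnboundedFunctionals.
Variables (R : realType) (E : completeNormedModType R).

Let bounded_scalar := [set f : E -> R | linear_for *%R f /\ bounded_map f].

Lemma bounded_scalar_projection (s : seq E) : exists P : {linear E -> E},
  [/\ forall x, x \in s -> P x = x,
      forall f : {scalar E}, bounded_map (f \o P) &
      exists n (v : 'I_n -> E), forall x, exists a : 'I_n -> R,
        P x = \sum_(i < n) a i *: v i].
Proof.
have [|||x x0|P [Ps PF Pfin]] := @finite_projection R E bounded_scalar _ _ _ _ s.
- by move=> f [].
- split; first by move=> a x y; rewrite mulr0 addr0.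
  by exists 0 => x; rewrite normr0 mul0r.
- move=> a f g [lf [M fM]] [lg [N gN]]; split.
    move=> c x y; rewrite lf lg !mulrDr addrACA; congr (_ + _).
    by congr (_ + _); rewrite mulrCA.
  exists (M + `|a| * N) => x; rewrite (le_trans (ler_normD _ _))// normrM mulrDl lerD//.
  by rewrite -mulrA ler_wpM2l.
- have [f [fle fx]] := norming_functional x.
  exists f; last by rewrite fx normr_eq0.
  by split; [exact: scalar_linear|exists 1 => y; rewrite mul1r].
- by exists P; split=> // f; have [] := PF f.
Qed.

(* The functionals vanish successively on longer initial segments of a dense
   sequence, hence are bounded on it, while their norms tend to infinity. *)
Lemma dense_proper_bounded_orbit :
  separable_space E -> infinite_dimensional [set: E] ->
  exists f : nat -> {scalar E}, [/\ forall n, bounded_map (f n),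
    dense (bounded_orbit f) & bounded_orbit f <> setT].
Proof.
move=> /separable_dense_sequence[y yd] infE.
have step n : exists f : {scalar E}, [/\ bounded_map f,
    forall k, (k < n)%N -> f (y k) = 0 & exists x, n%:R * `|x| < `|f x|].
  have [P [Ps PF [m [v Pv]]]] := bounded_scalar_projection (mkseq y n).
  have [x Px] : exists x, P x != x.
    apply: contrapT => nP; apply: infE; exists m, v; split=> // x _.
    have [a Pa] := Pv x; exists a; rewrite -Pa; apply: contrapT => xPx.
    by apply: nP; exists x; apply/eqP => /esym.
  have [g [gle gx]] := norming_functional (x - P x).
  have gx0 : 0 < g (x - P x) by rewrite gx normr_gt0 subr_eq0 eq_sym.
  (* Scaled so that the functional equals n|x| + 1 at x; composing with x - P x makes it vanish at
     the first n points. *)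
  pose c := (n%:R * `|x| + 1) / g (x - P x).
  have lf : linear_for *%R (fun z => c * g (z - P z)).
    move=> a z w; rewrite linearP/= opprD addrACA -scalerBr linearP/=.
    by rewrite mulrDr mulrCA.
  exists (linear_of lf); split=> [|k kn|] /=.
  - have [M gM] := PF g; exists (`|c| * (1 + M)) => z /=.
    rewrite normrM -mulrA ler_wpM2l// raddfB mulrDl mul1r.
    by apply: le_trans (ler_normB _ _) _; apply: lerD; [exact: gle|exact: gM].
  - have -> : P (y k) = y k by apply/Ps/mapP; exists k => //; rewrite mem_iota.
    by rewrite subrr raddf0 mulr0.
  - exists x; rewrite /c divfK ?gt_eqF//.
    by rewrite (lt_le_trans _ (ler_norm _))// ltrDl.
have /choice[f fP] := step.
have bf n : bounded_map (f n) by have [] := fP n.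
exists f; split=> //.
  apply/dense_normP => x e e0; have [m xm] := yd x e e0.
  exists (y m) => //; exists (\sum_(k < m.+1) `|f k (y m)|) => n.
  have [mn|nm] := ltnP m n.
    by have [_ -> //] := fP n; rewrite normr0 sumr_ge0.
  by rewrite (bigD1 (Ordinal (nm : (n < m.+1)%N)))//= lerDl sumr_ge0.
move=> fT.
(* If all orbits were bounded, uniform boundedness would give one [M] for all [f n] on the unit
   ball, contradicting the slope of [f n] once n exceeds [|M|]. *)
have [||M fM] := @Banach_Steinhauss R E R^o [set h | exists n, h = (f n : E -> R^o)] _ _ 1.
- move=> h [n ->]; split; last exact: scalar_linear.
  have [C C0 fC] := bounded_map_gt0 (bf n).
  by move=> r; exists (C * r) => x xr; rewrite (le_trans (fC x))// ler_pM2l.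
- move=> x; have [C xC] : bounded_orbit f x by rewrite fT.
  by exists C => h [n ->].
have [_ _ [x xn]] := fP (Num.bound `|M|).
have x0 : 0 < `|x|.
  rewrite normr_gt0; apply: contraTneq xn => ->.
  by rewrite raddf0 !normr0 mulr0 ltxx.
have := fM _ (ex_intro _ (Num.bound `|M|) erefl) (`|x|^-1 *: x).
rewrite normrZ normfV normr_id mulVf ?gt_eqF// lexx => /(_ isT).
rewrite linearZ/= normrM normfV normr_id ler_pdivrMl// => h.
have := lt_le_trans xn h; rewrite (mulrC `|x|) ltr_pM2r// ltNge.
by rewrite (le_trans (ler_norm M))// ltW// archi_boundP.
Qed.

End UnboundedFunctionals.

(** * Weak* separability and total sequences *)

Section WeakStar.
Variables (R : realType) (E : normedModType R).

Lemma bounded_scalar_weak_star (f : {scalar E}) : bounded_map f ->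
  (f : E -> R) \in [set f : {ptws E -> R^o} |
    linear (f : E -> R^o) /\ continuous (f : E -> R^o)].
Proof.
move=> bf; rewrite inE; split; first exact: scalar_linear.
by apply: (@bounded_map_continuous R E R^o) => //; exact: raddfB.
Qed.

Definition weak_star_functional (f : {scalar E}) (bf : bounded_map f) :
  weak_star_dual E := exist _ (f : E -> R) (bounded_scalar_weak_star bf).

Lemma weak_star_scalar (phi : weak_star_dual E) :
  exists2 f : {scalar E}, bounded_map f & (f : E -> R) = val phi.
Proof.
have := valP phi; rewrite inE => -[lf cf].
have lf' : linear_for *%R (val phi : E -> R) by exact: lf.
exists (linear_of lf') => //.
by have [M fM] := @continuous_bounded_map R E R^o (linear_of lf) cf; exists M.
Qed.

Lemma weak_star_eval_continuous (x : E) :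
  continuous (fun phi : weak_star_dual E => (val phi : E -> R^o) x).
Proof.
move=> phi.
apply: (@continuous_comp _ {ptws E -> R^o} _ (@set_val _ _) (@proj E (fun=> R^o) x)).
  exact: initial_continuous.
exact: proj_continuous.
Qed.

(** Being nonzero at a given x != 0 is a nonempty weak* open condition, hence met by a member of the
    countable dense set. Rescaling each member to norm at most 1 keeps its kernel. *)
Lemma weak_star_separable_total : separable_space (weak_star_dual E) ->
  exists f : nat -> {scalar E}, (forall n x, `|f n x| <= `|x|) /\
    forall x, (forall n, f n x = 0) -> x = 0.
Proof.
move=> [D cD dD].
have Dx x : x != 0 -> exists2 phi, D phi & (val phi : E -> R) x != 0.
  move=> x0; have [g [gle gx]] := norming_functional x.
  have bg : bounded_map g by exists 1 => y; rewrite mul1r.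
  have [||phi [phix Dphi]] := dD [set phi | (val phi : E -> R^o) x != 0].
  - by exists (weak_star_functional bg); rewrite /= gx normr_eq0.
  - apply: (@open_comp _ _ (fun phi : weak_star_dual E => (val phi : E -> R^o) x)
        [set r | r != 0]).
      by move=> ? _; exact: weak_star_eval_continuous.
    exact: open_neq.
  - by exists phi.
have [phi0 D0] : D !=set0.
  have l0 : linear_for *%R (fun _ : E => 0 : R) by move=> a x y; rewrite mulr0 addr0.
  have b0 : bounded_map (linear_of l0) by exists 0 => y; rewrite normr0 mul0r.
  have [||phi [_ Dphi]] := dD setT; [|exact: openT|by exists phi].
  by exists (weak_star_functional b0).
have [y [yD Dy]] := countable_enumeration cD D0.
have /choice[f fP] n : exists f : {scalar E}, (forall x, `|f x| <= `|x|) /\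
    exists2 c : R, c != 0 & forall x, (val (y n) : E -> R) x = c * f x.
  have [g /bounded_map_gt0[M M0 gM] gy] := weak_star_scalar (y n).
  have lf : linear_for *%R (fun x => M^-1 * g x).
    by move=> a x z; rewrite linearP/= mulrDr mulrCA.
  exists (linear_of lf); split=> [x|] /=.
    by rewrite normrM gtr0_norm ?invr_gt0// ler_pdivrMl.
  by exists M => [|x]; rewrite ?gt_eqF// mulVKf ?gt_eqF// gy.
exists f; split=> [n|x fx]; first by have [] := fP n.
apply/eqP/negP => /negP /Dx[phi /Dy[n <-]].
by have [_ [c _ ->]] := fP n; rewrite fx mulr0 eqxx.
Qed.

(** The filter of sets containing a finite-point neighbourhood converges to [phi]; for a supremum
    topology this is tested one coordinate at a time. *)
Lemma ptws_nbhsP (phi : {ptws E -> R^o}) (U : set {ptws E -> R^o}) : nbhs phi U ->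
  exists (s : seq E) (e : R), 0 < e /\
    forall psi : E -> R, (forall x, x \in s -> `|phi x - psi x| < e) -> U psi.
Proof.
pose F : set_system {ptws E -> R^o} :=
  [set U : set {ptws E -> R^o} | exists (s : seq E) (e : R), 0 < e /\
    forall psi : E -> R, (forall x, x \in s -> `|phi x - psi x| < e) -> U psi].
have FF : Filter F.
  split=> [|A B [s [e [e0 sA]]] [t [d [d0 tB]]]|A B AB [s [e [e0 sA]]]].
  - by exists [::], 1.
  - exists (s ++ t), (Num.min e d); split; first by rewrite lt_min e0.
    move=> psi h; split; [apply: sA|apply: tB] => x xs.
      by have := h x; rewrite mem_cat xs lt_min => /(_ isT)/andP[].
    by have := h x; rewrite mem_cat xs orbT lt_min => /(_ isT)/andP[].
  - by exists s, e; split=> // psi h; apply/AB/sA.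
suff : F --> phi by apply.
apply/cvg_sup => x A /= [B [[W oW <-] Wphi] WA].
have /nbhs_ballP[e /= e0 eW] : nbhs (phi x) W by exact: open_nbhs_nbhs.
exists [:: x], e; split=> // psi h; apply: WA; apply: eW.
by rewrite -ball_normE; apply: h; rewrite inE.
Qed.

(** Rational combinations of the [f n] are weak* dense. The functionals approximable by them on the
    finite set [xs] form a separating space [V]; a finite-rank [P] fixing [xs] puts every g composed
    with [P] in [V], and this composite agrees with g on [xs]. *)
Lemma total_weak_star_separable (f : nat -> {scalar E}) :
  (forall n, bounded_map (f n)) -> (forall x, (forall n, f n x = 0) -> x = 0) ->
  separable_space (weak_star_dual E).
Proof.
move=> bf ftot.
pose comb (s : seq (rat * nat)) (x : E) : R := \sum_(p <- s) ratr p.1 * f p.2 x.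
have lcomb s : linear_for *%R (comb s).
  move=> a x y; rewrite /comb mulr_sumr -big_split/=; apply: eq_bigr => p _.
  by rewrite linearP/= mulrDr mulrCA.
have bcomb s : bounded_map (linear_of (lcomb s)).
  elim: s => [|p s [M sM]]; first by exists 0 => x; rewrite /= /comb big_nil normr0 mul0r.
  have [N fN] := bf p.2; exists (`|ratr p.1| * N + M) => x.
  rewrite /= /comb big_cons (le_trans (ler_normD _ _))// mulrDl.
  by apply: lerD; [rewrite normrM -mulrA ler_wpM2l|exact: sM].
exists (range (fun s => weak_star_functional (bcomb s))).
  exact: countable_range.
move=> O [phi Ophi] [O' oO' OO'].
have : nbhs (val phi : {ptws E -> R^o}) O'.
  by apply: open_nbhs_nbhs; split=> //; move: Ophi; rewrite -OO'.
move=> /ptws_nbhsP[xs [e [e0 xsO]]].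
pose V := [set g : E -> R | linear_for *%R g /\ forall d, 0 < d ->
  exists s, forall x, x \in xs -> `|g x - comb s x| < d].
have comb_scale q t x : comb [seq (q * p.1, p.2) | p <- t] x = ratr q * comb t x.
  rewrite /comb big_map mulr_sumr; apply: eq_bigr => p _.
  by rewrite /= rmorphM; exact: esym (mulrA _ _ _).
have VD a g h : V g -> V h -> V (fun x => g x + a * h x).
  move=> [lg Vg] [lh Vh]; split.
    by move=> c x y; rewrite lg lh !mulrDr addrACA (mulrCA a).
  move=> d d0; pose B := 1 + \sum_(x <- xs) `|h x|.
  have B0 : 0 < B by rewrite ltr_wpDr// sumr_ge0.
  have hB x : x \in xs -> `|h x| <= B.
    move=> xxs; rewrite /B (big_rem x)//= addrCA lerDl addr_ge0//.
    by rewrite sumr_ge0.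
  have d4 : 0 < d / 4 by rewrite divr_gt0.
  (* The rational q is fixed before the approximation of [h], whose tolerance depends on it. *)
  have /rat_in_itvoo[q] : a < a + d / 4 / B by rewrite ltrDl divr_gt0.
  rewrite in_itv/= => /andP[aq qa].
  have [s sg] := Vg _ d4.
  have q1 : 0 < `|ratr q| + 1 :> R by rewrite ltr_wpDl.
  have [t th] := Vh _ (divr_gt0 d4 q1).
  exists (s ++ [seq (q * p.1, p.2) | p <- t]) => x xxs.
  have -> : comb (s ++ [seq (q * p.1, p.2) | p <- t]) x = comb s x + ratr q * comb t x.
    by rewrite -comb_scale /comb big_cat.
  have -> : g x + a * h x - (comb s x + ratr q * comb t x) =
      (g x - comb s x) + ((a - ratr q) * h x + ratr q * (h x - comb t x)) by lra.
  have h1 := sg x xxs.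
  have h2 : `|(a - ratr q) * h x| <= d / 4.
    rewrite normrM -[leRHS](divfK (lt0r_neq0 B0)) ler_pM//; last exact: hB.
    by rewrite distrC gtr0_norm ?subr_gt0// lerBlDl ltW.
  have h3 : `|ratr q * (h x - comb t x)| <= d / 4.
    have := th x xxs; rewrite ltr_pdivlMr// => /ltW; apply: le_trans.
    by rewrite normrM mulrC ler_wpM2l// lerDl.
  have := ler_normD (g x - comb s x) ((a - ratr q) * h x + ratr q * (h x - comb t x)).
  have := ler_normD ((a - ratr q) * h x) (ratr q * (h x - comb t x)).
  by lra.
have [|||x x0|P [Pxs PV _]] := @finite_projection R E V _ _ _ _ xs.
- by move=> g [].
- split; first by move=> a x y; rewrite mulr0 addr0.
  by move=> d d0; exists [::] => x _; rewrite /comb big_nil subrr normr0.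
- exact: VD.
- have [n fn] : exists n, f n x != 0.
    apply: contrapT => nf; move/eqP: x0; apply; apply: ftot => n.
    by apply: contrapT => fn; apply: nf; exists n; apply/eqP.
  exists (f n) => //; split; first exact: scalar_linear.
  move=> d d0; exists [:: (1, n)] => y _.
  by rewrite /comb big_seq1 rmorph1 mul1r subrr normr0.
have [g bg gphi] := weak_star_scalar phi.
have [_ /(_ e e0)[s se]] := PV g.
exists (weak_star_functional (bcomb s)); split; last by exists s.
rewrite -OO'; apply: xsO => x xxs /=.
by have := se x xxs; rewrite /= Pxs// -gphi.
Qed.

End WeakStar.

(** * Separable quotients of quasicomplements *)

Lemma bounded_quotient_pi (R : realType) (E : normedModType R)
  (X : closedSubspace E) : bounded_map (quotient_pi X).
Proof. by exists 1 => x; rewrite mul1r ler_quotient_pi. Qed.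

(** Functionals norming a dense sequence are total: a common zero x near [y n] forces [y n], hence
    x, to be small. *)
Lemma separable_total (R : realType) (V : normedModType R) :
  separable_space V ->
  exists f : nat -> {scalar V}, (forall n, bounded_map (f n)) /\
    forall x, (forall n, f n x = 0) -> x = 0.
Proof.
move=> /separable_dense_sequence[y yd].
have /choice[f fP] n := norming_functional (y n).
exists f; split=> [n|x fx].
  by exists 1 => x; rewrite mul1r; have [-> _] := fP n.
apply/eqP; rewrite -normr_le0; apply/ler_addgt0Pr => e e0; rewrite add0r.
have [n xn] := yd x _ (divr_gt0 e0 (ltr0n R 2)).
have [fle fy] := fP n.
have := fle (x - y n); rewrite raddfB/= fx sub0r normrN fy normr_id.
have := ler_normD (x - y n) (y n); rewrite subrK.
by lra.
Qed.

Section QuasicomplementSeparable.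
Variables (R : realType) (E : completeNormedModType R).

(** As X + Y is dense, the image of X in E/Y is dense, and so is that of a countable dense subset of
    X. *)
Lemma quasicomplement_quotient_separable (X Y : closedSubspace E) :
  separable_space (set_type (X : set E)) -> quasicomplement X Y ->
  separable_space (quotient_space Y).
Proof.
move=> [D cD dD] [/dense_normP dXY _].
exists [set quotient_pi Y (val d) | d in D].
  exact: sub_countable (card_image_le _ _) cD.
apply/dense_normP => q e e0; have e2 : 0 < e / 2 by rewrite divr_gt0.
have [_ [x Xx [y Yy <-]] xye] := dXY (repr q) _ e2.
have [||d [/= xd Dd]] := dD [set d : set_type (X : set E) | `|x - val d| < e / 2].
- by exists (exist _ x (mem_set Xx)); rewrite /= subrr normr0.
- have : open [set z : E | `|x - z| < e / 2].
    have := ball_open x (e / 2); by rewrite -ball_normE.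
  by move=> oB; exists [set z : E | `|x - z| < e / 2].
exists (quotient_pi Y (val d)); first by exists d.
rewrite -[q]quotient_piK -raddfB/=.
have -> : quotient_pi Y (repr q - val d) = quotient_pi Y (repr q - (x + y) + (x - val d)).
  rewrite (addrC x y) opprD !addrA subrK (addrAC (repr q)) [RHS]raddfB/=.
  by rewrite ((quotient_pi_eq0 Y y).2 Yy) subr0.
rewrite (le_lt_trans (ler_quotient_pi _ _))// (le_lt_trans (ler_normD _ _))//.
by rewrite [e]splitr ltrD.
Qed.

Lemma total_of_quasicomplements (X : closedSubspace E) :
  separable_space (set_type (X : set E)) ->
  has_separable_quotient (quotient_space X) ->
  (forall S : set E, proper_dense_operator_range S -> (X : set E) `<=` S ->
    exists Y : closedSubspace E, quasicomplement X Y /\ S `&` (Y : set E) = [set 0]) ->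
  separable_space (weak_star_dual E).
Proof.
move=> sX [N [infN sN]] h.
have [f [bf df fT]] := dense_proper_bounded_orbit sN infN.
pose rho : {linear E -> quotient_space N} := quotient_pi N \o quotient_pi X.
have brho : bounded_map rho by apply: bounded_map_comp; exact: bounded_quotient_pi.
have brhof (g : {scalar quotient_space N}) : bounded_map g -> bounded_map (g \o rho).
  by move=> bg; exact: bounded_map_comp.
have rho_repr q : rho (repr (repr q)) = q by rewrite /= !quotient_piK.
pose S := bounded_orbit (fun n => f n \o rho : {scalar E}).
have [|x Xx|Y [XY SY]] := h S.
- split.
  + by apply: bounded_orbit_operator_range => n; exact: brhof.
  + move=> ST; apply: fT; apply/seteqP; split=> // q _.
    by have : S (repr (repr q)) by [rewrite ST]; rewrite /S /bounded_orbit /= !quotient_piK.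
  + apply/dense_normP => x e e0.
    have [q fq xq] := (dense_normP _).1 df (rho x) e e0.
    rewrite distrC in xq.
    have [q' q'q q'x] := quotient_pi_lift xq.
    have [y yq' yx] := quotient_pi_lift q'x.
    by exists y; rewrite 1?distrC// /S /bounded_orbit /= yq' q'q.
- by exists 0 => n /=; rewrite (quotient_pi_eq0 X x).2// !raddf0 normr0.
have [a [ba atot]] := separable_total sN.
have [b [bb btot]] := separable_total (quasicomplement_quotient_separable sX XY).
pose a' n : {scalar E} := a n \o rho.
pose b' n : {scalar E} := b n \o quotient_pi Y.
(* A common zero of the even functionals lies in the kernel of [rho], hence in [S]; a common zero of
   the odd ones lies in [Y]. *)
pose g n := if odd n then b' n./2 else a' n./2.
apply: (@total_weak_star_separable _ _ g) => [n|x gx].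
  rewrite /g; case: (odd n); last exact: brhof.
  by apply: bounded_map_comp => //; exact: bounded_quotient_pi.
have rx : rho x = 0.
  by apply: atot => n; have := gx n.*2; rewrite /g odd_double doubleK.
have px : quotient_pi Y x = 0.
  by apply: btot => n; have := gx n.*2.+1; rewrite /g /= odd_double /= uphalf_double.
have : (S `&` (Y : set E)) x.
  split; last exact/quotient_pi_eq0.
  exists 0 => n; have -> : (f n \o rho : {scalar E}) x = f n (rho x) by [].
  by rewrite rx raddf0 normr0.
by rewrite SY.
Qed.

End QuasicomplementSeparable.

(** * Separable subspaces with large quotients *)

(** A spanning family of size n would factor the identity matrix of size n + 1 through dimension
    n. *)
Lemma biorthogonal_infinite_dimensional (R : realType) (V : lmodType R)
    (A : set V) (x : nat -> V) (f : nat -> {scalar V}) :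
  (forall n, A (x n)) -> (forall i j, f i (x j) = (i == j)%:R) ->
  infinite_dimensional A.
Proof.
move=> Ax fx [n [v [_ h]]].
have /choice[a xa] j := h _ (Ax j).
pose B := \matrix_(j < n.+1, i < n) a j i.
pose C := \matrix_(i < n, k < n.+1) f k (v i).
have : B *m C = 1%:M.
  apply/matrixP => j k; rewrite !mxE.
  have -> : (j == k) = (k == j :> nat) by rewrite eq_sym.
  rewrite -fx xa raddf_sum/=; apply: eq_bigr => i _.
  by rewrite !mxE linearZ.
by move=> /mulmx1_min; rewrite ltnn.
Qed.

(** * Common kernels and functionals on quotients *)

Section Kernel.
Variables (R : realType) (E : normedModType R).
Variables (f : nat -> {scalar E}) (bf : forall n, bounded_map (f n)).

Let kernel : set E := [set x | forall n, f n x = 0].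

Let kernel_submod : submod_closed [pred x | x \in kernel].
Proof.
split; first by rewrite inE => n; rewrite raddf0.
by move=> a x y; rewrite !inE => fx fy n; rewrite linearP/= fx fy mulr0 addr0.
Qed.

Let kernel_closed : closed kernel.
Proof.
apply: closed_normP => x h n; apply/eqP; rewrite -normr_le0.
have [M M0 fM] := bounded_map_gt0 (bf n).
apply/ler_addgt0Pr => e e0; rewrite add0r.
have [a fa] := h _ (divr_gt0 e0 M0).
rewrite ltr_pdivlMr// mulrC => xa; have := fM (x - a).
by rewrite raddfB/= fa subr0; lra.
Qed.

Definition kernel_subspace : closedSubspace E :=
  ClosedSubspace kernel_submod kernel_closed.

Lemma kernel_subspaceE (x : E) :
  (kernel_subspace : set E) x <-> forall n, f n x = 0.
Proof. by []. Qed.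

End Kernel.

Lemma quotient_functional (R : realType) (E : normedModType R)
    (X : closedSubspace E) (f : {scalar E}) :
  bounded_map f -> (forall x, (X : set E) x -> f x = 0) ->
  exists g : {scalar quotient_space X}, bounded_map g /\
    forall x, g (quotient_pi X x) = f x.
Proof.
move=> /bounded_map_gt0[M M0 fM] fX.
have fpi x y : quotient_pi X x = quotient_pi X y -> f x = f y.
  by move=> /quotient_pi_eq /fX /eqP; rewrite raddfB subr_eq0 => /eqP.
have lg : linear_for *%R (fun q : quotient_space X => f (repr q)).
  move=> a p q; rewrite -linearP; apply: fpi.
  by rewrite linearP/= !quotient_piK.
exists (linear_of lg); split=> [|x]; last by apply: fpi; rewrite quotient_piK.
exists M => q /=; apply/ler_addgt0Pr => e e0.
have [x xq xe] := quotient_norm_lt q (divr_gt0 e0 M0).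
rewrite (@fpi (repr q) x) ?quotient_piK// (le_trans (fM x))//.
have := ltW xe; rewrite -(ler_pM2l M0) mulrDr mulrCA divff ?gt_eqF// mulr1.
by rewrite quotient_normE.
Qed.

(** * Closed spans of sequences *)

Section RationalSpan.
Variables (R : realType) (E : normedModType R) (u : nat -> E).

Let comb (s : seq (rat * nat)) : E := \sum_(p <- s) (ratr p.1 : R) *: u p.2.

Let comb_add s t : comb s + comb t = comb (s ++ t).
Proof. by rewrite /comb big_cat. Qed.

Let comb_scale q t : comb [seq (q * p.1, p.2) | p <- t] = (ratr q : R) *: comb t.
Proof.
rewrite /comb big_map scaler_sumr; apply: eq_bigr => p _ /=.
by rewrite scalerA rmorphM.
Qed.

Let span : set E := closure (range comb).

Let span_submod : submod_closed [pred x | x \in span].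
Proof.
split; first by rewrite inE; apply: subset_closure; exists [::] => //; rewrite /comb big_nil.
move=> a x y; rewrite !inE => /closure_normP cx /closure_normP cy.
apply/closure_normP => e e0.
have e3 : 0 < e / 3 by rewrite divr_gt0.
have nx : 0 < `|x| + 1 by rewrite ltr_wpDl.
have /rat_in_itvoo[q] : a < a + e / 3 / (`|x| + 1) by rewrite ltrDl !divr_gt0.
rewrite in_itv/= => /andP[aq qa].
have nq : 0 < `|ratr q : R| + 1 by rewrite ltr_wpDl.
have [_ [s _ <-] xs] := cx _ (divr_gt0 e3 nq).
have [_ [t _ <-] yt] := cy _ e3.
exists (comb ([seq (q * p.1, p.2) | p <- s] ++ t)).
  by exists ([seq (q * p.1, p.2) | p <- s] ++ t).
rewrite -comb_add comb_scale opprD addrACA.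
have -> : a *: x - ratr q *: comb s = (a - ratr q) *: x + ratr q *: (x - comb s).
  by rewrite scalerBl scalerBr addrA subrK.
rewrite -addrA (le_lt_trans (ler_normD _ _))//.
have h1 : `|(a - ratr q) *: x| <= e / 3.
  rewrite normrZ distrC gtr0_norm ?subr_gt0//.
  have : ratr q - a <= e / 3 / (`|x| + 1) by rewrite lerBlDl ltW.
  rewrite ler_pdivlMr// mulrDr mulr1; apply: le_trans.
  by rewrite lerDl subr_ge0 ltW.
have h2 : `|(ratr q : R) *: (x - comb s)| <= e / 3.
  rewrite normrZ; move: xs; rewrite ltr_pdivlMr// mulrDr mulr1 => /ltW.
  by apply: le_trans; rewrite mulrC lerDl.
have := ler_normD ((ratr q : R) *: (x - comb s)) (y - comb t).
by lra.
Qed.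

Definition closed_span : closedSubspace E :=
  ClosedSubspace span_submod (@closed_closure _ _).

Lemma closed_span_mem n : (closed_span : set E) (u n).
Proof.
apply: subset_closure; exists [:: (1, n)] => //.
by rewrite /comb big_seq1 rmorph1 scale1r.
Qed.

Lemma closed_span_separable : separable_space (set_type (closed_span : set E)).
Proof.
have cs s : comb s \in (closed_span : set E).
  by rewrite inE; apply: subset_closure; exists s.
exists (range (fun s => exist _ (comb s) (cs s) : set_type (closed_span : set E))).
  exact: countable_range.
move=> O [[x xO] Ox] [O' oO' OO'].
have sx : span x := set_mem xO.
have /open_nbhs_nbhs On : open_nbhs x O' by split=> //; move: Ox; rewrite -OO'.
have [_ [[s _ <-] O's]] := sx _ On.
by exists (exist _ (comb s) (cs s)); split; [rewrite -OO'|exists s].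
Qed.

Lemma closed_span_vanish (f : {scalar E}) : bounded_map f ->
  (forall n, f (u n) = 0) -> forall x, (closed_span : set E) x -> f x = 0.
Proof.
move=> /bounded_map_gt0[M M0 fM] fu x /closure_normP h.
apply/eqP; rewrite -normr_le0; apply/ler_addgt0Pr => e e0; rewrite add0r.
have [_ [s _ <-]] := h _ (divr_gt0 e0 M0).
rewrite ltr_pdivlMr// mulrC => /ltW; apply: le_trans.
have fs : f (comb s) = 0.
  by rewrite raddf_sum big1// => p _; rewrite /= linearZ/= fu mulr0.
by have := fM (x - comb s); rewrite raddfB/= fs subr0.
Qed.

End RationalSpan.

(** The even vectors [e k] span [X]. The odd functionals vanish on [X], descend to E/X, and have
    common kernel [W] there; the odd vectors keep both E/X and its quotient by [W]
    infinite-dimensional. *)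
Lemma exists_separable_subspace (R : realType) (E : completeNormedModType R) :
  has_separable_quotient E -> exists X : closedSubspace E,
  [/\ separable_space (set_type (X : set E)), infinite_dimensional (X : set E),
      infinite_codimensional X & has_separable_quotient (quotient_space X)].
Proof.
move=> [N [infN sN]].
have [f [bf df fT]] := dense_proper_bounded_orbit sN infN.
have [G [A [cA rA]]] := bounded_orbit_operator_range bf.
have bA : bounded_map A by exact: continuous_bounded_map.
have dA : dense (range A) by rewrite rA.
have nA : range A <> setT by rewrite rA.
have [g [th [thg bth _ _]]] := biorthogonal_system bA dA nA (fun=> ltr01).
pose e k := repr (A (g k)).
pose th' k : {scalar E} := th k \o quotient_pi N.
have bth' k : bounded_map (th' k).
  by apply: bounded_map_comp => //; exact: bounded_quotient_pi.
have th'e i j : th' i (e j) = (i == j)%:R by rewrite /th' /e /= quotient_piK thg.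
pose X := closed_span (fun k => e k.*2).
have th'X k x : (X : set E) x -> th' k.*2.+1 x = 0.
  apply: closed_span_vanish => // n; rewrite th'e.
  by rewrite (_ : _ == _ = false)//; apply/negP => /eqP /(congr1 odd); rewrite /= !odd_double.
have /choice[tX] k := quotient_functional (bth' k.*2.+1) (@th'X k).
move=> /all_and2[btX tXpi].
have tXe i j : tX i (quotient_pi X (e j.*2.+1)) = (i == j)%:R.
  by rewrite tXpi th'e eqSS -!muln2 eqn_pmul2r.
pose W := kernel_subspace btX.
have /choice[tW] k := quotient_functional (btX k) (fun q (Wq : (W : set _) q) => Wq k).
move=> /all_and2[btW tWpi].
exists X; split.
- exact: closed_span_separable.
- apply: (@biorthogonal_infinite_dimensional _ _ _ (fun k => e k.*2) (fun k => th' k.*2)).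
    by move=> n; exact: closed_span_mem.
  by move=> i j; rewrite th'e -!muln2 eqn_pmul2r.
- exact: (@biorthogonal_infinite_dimensional _ _ _ (fun k => quotient_pi X (e k.*2.+1)) tX).
exists W; split.
  apply: (@biorthogonal_infinite_dimensional _ _ _
    (fun k => quotient_pi W (quotient_pi X (e k.*2.+1))) tW) => // i j.
  by rewrite tWpi tXe.
have [D cD dD] := sN.
exists [set quotient_pi W (quotient_pi X (repr d)) | d in D].
  exact: sub_countable (card_image_le _ _) cD.
apply/dense_normP => q d d0.
have [c Dc qc] := (dense_normP _).1 dD (quotient_pi N (repr (repr q))) d d0.
rewrite distrC in qc.
have [y yc yq] := quotient_pi_lift qc.
exists (quotient_pi W (quotient_pi X (repr c))); first by exists c.
(* All the functionals factor through E/N, so points equal modulo [N] have the same class modulo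
   [W]; density is thus inherited from E/N. *)
have -> : quotient_pi W (quotient_pi X (repr c)) = quotient_pi W (quotient_pi X y).
  apply/quotient_pi_eq/kernel_subspaceE => n.
  rewrite -raddfB tXpi /th' /= raddfB/= quotient_piK yc subrr raddf0//.
rewrite distrC -[q]quotient_piK -[repr q]quotient_piK -!raddfB.
by rewrite (le_lt_trans _ yq)// (le_trans (ler_quotient_pi _ _))// ler_quotient_pi.
Qed.

(** * Weighted sums *)

Section FiniteCodimension.
Variables (R : realType) (V : lmodType R).

Lemma finite_dimensional_of_kernel (A : set V) (h : {scalar V}) :
  (forall a x y, A x -> A y -> A (a *: x + y)) ->
  finite_dimensional (A `&` [set x | h x = 0]) -> finite_dimensional A.
Proof.
move=> AD [n [v [Av vspan]]].
have [h0|[w [Aw hw]]] : (forall x, A x -> h x = 0) \/ exists w, A w /\ h w != 0.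
  have [?|nh] := pselect (exists w, A w /\ h w != 0); [by right|left=> x Ax].
  by apply: contrapT => hx; apply: nh; exists x; split=> //; exact/eqP.
  exists n, v; split=> [i|x Ax]; first by have [] := Av i.
  by apply: vspan; split=> //; exact: h0.
exists n.+1, (fun i => if unlift ord0 i is Some j then v j else w); split=> [i|x Ax].
  by case: unliftP => [j|] _ //; have [] := Av j.
have [|a xa] := vspan (- (h x / h w) *: w + x).
  by split; [exact: AD|rewrite /= linearP/= mulNr divfK// addNr].
exists (fun i => if unlift ord0 i is Some j then a j else h x / h w).
rewrite big_ord_recl unlift_none /=.
under eq_bigr do rewrite liftK.
by rewrite -xa scaleNr addrA subrr add0r.
Qed.

Lemma infinite_dimensional_kernel (A : set V) (h : nat -> {scalar V}) (n : nat) :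
  (forall a x y, A x -> A y -> A (a *: x + y)) -> infinite_dimensional A ->
  exists z, [/\ A z, z != 0 & forall i, (i < n)%N -> h i z = 0].
Proof.
move=> AD infA.
pose B m := A `&` [set x | forall i, (i < m)%N -> h i x = 0].
have infB m : infinite_dimensional (B m).
  elim: m => [|m ih]; first by rewrite /B (_ : [set x | _] = setT) ?setIT// -subTset.
  move=> finB; apply: ih; apply: (@finite_dimensional_of_kernel _ (h m)).
    move=> a x y [Ax hx] [Ay hy]; split; first exact: AD.
    by move=> i im; rewrite linearP/= hx// hy// mulr0 addr0.
  rewrite (_ : _ `&` _ = B m.+1)//; apply/seteqP; split=> [x [[Ax hx] hmx]|x [Ax hx]].
    split=> // i; rewrite ltnS leq_eqVlt => /predU1P[->//|]; exact: hx.
  by split; [split=> // i im; apply: hx; rewrite ltnW|exact: hx].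
apply: contrapT => nz; apply: (infB n); exists 0%N, (fun=> 0); split=> [[]//|x [Ax hx]].
exists (fun=> 0); rewrite big_ord0; apply: contrapT => x0; apply: nz; exists x.
by split=> //; apply/eqP.
Qed.

End FiniteCodimension.

Section WeightedSums.
Variables (R : realType) (E : completeNormedModType R).
Variables (x : nat -> E) (M : R).
Hypothesis xM : forall k, `|x k| <= M.

Definition weighted_sum (c : nat -> R) : E := limn (series (fun k => c k *: x k)).

Let term_le c C : (forall k, `|c k| <= C * 2^-1 ^+ k) ->
  forall k, `|c k *: x k| <= C * M * 2^-1 ^+ k.
Proof. by move=> cC k; rewrite normrZ mulrAC ler_pM. Qed.

Lemma weighted_sum_cvg c C : (forall k, `|c k| <= C * 2^-1 ^+ k) ->
  series (fun k => c k *: x k) @ \oo --> weighted_sum c.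
Proof. by move=> cC; apply: cvg_geometric_bound; exact: term_le. Qed.

Lemma weighted_sum_norm c C : (forall k, `|c k| <= C * 2^-1 ^+ k) ->
  `|weighted_sum c| <= 2 * C * M.
Proof.
move=> cC; apply/ler_addgt0Pr => e e0.
have /cvgrPdist_lt/(_ _ e0)[n _ /(_ n (leqnn n)) /= sn] := weighted_sum_cvg cC.
have CM : 0 <= C * M by have := le_trans (normr_ge0 _) (term_le cC 0%N); rewrite mulr1.
(* Keeping the geometric remainder makes the induction close. *)
have : `|series (fun k => c k *: x k) n| <= C * M * (2 - 2 * 2^-1 ^+ n).
  elim: n {sn} => [|n ih]; first by rewrite /series/= big_geq// normr0 mulr1 subrr mulr0.
  rewrite seriesSr (le_trans (ler_normD _ _))// (le_trans (lerD ih (term_le cC n)))//.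
  by rewrite exprS -mulrDr ler_wpM2l//; lra.
have : 0 <= C * M * 2^-1 ^+ n by rewrite mulr_ge0.
have := ler_normD (weighted_sum c - series (fun k => c k *: x k) n)
  (series (fun k => c k *: x k) n).
by rewrite subrK; lra.
Qed.

Lemma weighted_sum_linear a c d C D : (forall k, `|c k| <= C * 2^-1 ^+ k) ->
  (forall k, `|d k| <= D * 2^-1 ^+ k) ->
  weighted_sum (fun k => a * c k + d k) = a *: weighted_sum c + weighted_sum d.
Proof.
move=> /weighted_sum_cvg cc /weighted_sum_cvg cd; apply: cvg_lim => //.
rewrite (_ : series _ = (fun n => a *: series (fun k => c k *: x k) n +
    series (fun k => d k *: x k) n)).
  by apply: cvgD => //; exact: cvgZr.
apply/funext => n; rewrite /series/= scaler_sumr -big_split/=.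
by apply: eq_bigr => k _; rewrite scalerDl scalerA.
Qed.

Lemma weighted_sum_functional c C (phi : {scalar E}) : bounded_map phi ->
  (forall k, `|c k| <= C * 2^-1 ^+ k) ->
  (\sum_(0 <= k < n) c k * phi (x k)) @[n --> \oo] --> phi (weighted_sum c).
Proof.
move=> bphi /weighted_sum_cvg cc.
rewrite (_ : (fun n => _) = (fun n => phi (series (fun k => c k *: x k) n))).
  have cphi : continuous (phi : E -> R^o).
    by apply: (@bounded_map_continuous R E R^o) => //; exact: raddfB.
  exact: cvg_comp cc (cphi _).
apply/funext => n; rewrite /series/= raddf_sum/=.
by apply: eq_bigr => k _; rewrite linearZ.
Qed.

Lemma weighted_sum_coord c C (th : nat -> {scalar E}) : (forall k, bounded_map (th k)) ->
  (forall i j, th i (x j) = (i == j)%:R) ->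
  (forall k, `|c k| <= C * 2^-1 ^+ k) ->
  forall j, th j (weighted_sum c) = c j.
Proof.
move=> bth thx cC j.
have cw := weighted_sum_functional (bth j) cC.
rewrite -(cvg_lim (@Rhausdorff R) cw); apply: cvg_lim => //.
apply: cvg_near_cst; exists j.+1 => // n /= jn.
rewrite (@big_cat_nat _ _ _ j.+1)//= big_nat_recr//= big1_seq ?add0r; last first.
  move=> k /andP[_]; rewrite mem_index_iota => /andP[_ kj].
  by rewrite thx gtn_eqF// mulr0.
rewrite thx eqxx mulr1 big1_seq ?addr0// => k /andP[_].
rewrite mem_index_iota => /andP[jk _].
by rewrite thx ltn_eqF// mulr0.
Qed.

End WeightedSums.

(** * A rapidly decreasing weight sequence *)

Section FastDecay.
Variable R : realType.

(* Fast enough for the tail after j to be dominated by 2^-j * decay j, a lower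
   bound for the diagonal terms of a triangular family. *)
Fixpoint decay (k : nat) : R :=
  if k is j.+1 then decay j * 2^-1 ^+ (j + 5) else 16^-1.

Lemma decay_gt0 k : 0 < decay k.
Proof. by elim: k => [|k ih] /=; rewrite ?invr_gt0// mulr_gt0// exprn_gt0// invr_gt0. Qed.

Lemma decayS_le k : decay k.+1 <= decay k * 2^-1.
Proof.
rewrite /= ler_pM2l ?decay_gt0// addnS exprS ler_piMr ?invr_ge0//.
by rewrite exprn_ile1 ?invr_ge0// invf_le1// ler1n.
Qed.

Lemma decay_le k : decay k <= 16^-1 * 2^-1 ^+ k.
Proof.
elim: k => [|k ih]; first by rewrite expr0 mulr1.
by rewrite (le_trans (decayS_le k))// exprSr mulrA ler_wpM2r ?invr_ge0.
Qed.

Lemma decay_tail m n : (m <= n)%N -> \sum_(m <= k < n) decay k <= 2 * decay m.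
Proof.
move=> mn; have : \sum_(m <= k < n) decay k <= \sum_(m <= k < n) (- 2 * decay k.+1 - - 2 * decay k).
  by apply: ler_sum => k _; have := decayS_le k; lra.
rewrite telescope_sumr// => /le_trans; apply.
by have := decay_gt0 n; lra.
Qed.

Lemma decay_next k : decay k.+1 = 32^-1 * (2^-1 ^+ k * decay k).
Proof. by rewrite /= exprD [2^-1 ^+ 5]exprVn -natrX [2^-1 ^+ k * _]mulrC [LHS]mulrC -mulrA. Qed.

End FastDecay.

(** * Construction of quasicomplements *)

(** Finitely many functionals have a common nonzero zero in the infinite-dimensional [X], which
    gives [z k]. Adding to [f k] the multiple 2^-k of a functional norming [z k], with the sign of
    [f k (z k)], prevents cancellation on the diagonal. *)
Lemma triangular_perturbation (R : realType) (E : normedModType R)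
    (X : closedSubspace E) (f : nat -> {scalar E}) :
  infinite_dimensional (X : set E) ->
  exists (z : nat -> E) (h : nat -> {scalar E}), forall k,
  [/\ (X : set E) (z k), `|z k| = 1, forall i, (i < k)%N -> h i (z k) = 0,
      2^-1 ^+ k <= `|h k (z k)| &
      forall y, `|h k y - f k y| <= 2^-1 ^+ k * `|y|].
Proof.
move=> infX.
pose P k (p : nat -> E * {scalar E}) (t : E * {scalar E}) :=
  [/\ (X : set E) t.1, `|t.1| = 1, forall i, (i < k)%N -> (p i).2 t.1 = 0,
      2^-1 ^+ k <= `|t.2 t.1| &
      forall y, `|t.2 y - f k y| <= 2^-1 ^+ k * `|y|].
have [|k p _|p pP] := @course_of_values_choice _ (0, f 0%N) P.
- by move=> k p q t pq [? ? t3 ? ?]; split=> // i ik; rewrite -pq//; exact: t3.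
- have [|w [Xw w0 hw]] := @infinite_dimensional_kernel _ _ _ (fun i => (p i).2) k _ infX.
    by move=> a x y; exact: closedSubspaceZD.
  have nw : 0 < `|w| by rewrite normr_gt0.
  pose z := `|w|^-1 *: w.
  have z1 : `|z| = 1 by rewrite normrZ normfV normr_id mulVf// gt_eqF.
  have [q [qle qz]] := norming_functional z; rewrite z1 in qz.
  pose s : R := if 0 <= f k z then 1 else -1.
  have s1 : `|s| = 1 by rewrite /s; case: ifP; rewrite ?normrN ?normr1.
  have lh : linear_for *%R (fun y => f k y + s * 2^-1 ^+ k * q y).
    by move=> a x y; rewrite !linearP/= !mulrDr addrACA (mulrCA a).
  have p0 : 0 < 2^-1 ^+ k :> R by rewrite exprn_gt0// invr_gt0.
  exists (z, linear_of lh); split=> //=.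
  + exact: closedSubspaceZ.
  + by move=> i ik; rewrite linearZ/= hw// mulr0.
  + rewrite qz mulr1 /s; case: ifPn => [f0|]; last rewrite -ltNge => f0.
      by rewrite mul1r (le_trans _ (ler_norm _))// lerDr.
    by rewrite mulN1r -normrN (le_trans _ (ler_norm _))//; lra.
  + by move=> y; rewrite addrAC subrr add0r !normrM s1 mul1r (gtr0_norm p0) ler_pM2l.
by exists (fun k => (p k).1), (fun k => (p k).2) => k; exact: pP.
Qed.

Section Quasicomplement.
Variables (R : realType) (E : completeNormedModType R) (X : closedSubspace E).
Variables (G : completeNormedModType R) (A : {linear G -> E}).
Hypotheses (bA : bounded_map A) (dA : dense (range A)) (nA : range A <> setT).
Hypothesis XA : (X : set E) `<=` range A.
Variables (rho : nat -> R).
Hypothesis rho_gt0 : forall k, 0 < rho k.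

(** The biorthogonal system of the induced map G -> E/X, which is not onto because [range A]
    contains [X]. Its vectors have norm at most 1 and are lifted to norm at most 2. *)
Lemma biorthogonal_mod_subspace :
  exists (x : nat -> E) (th : nat -> {scalar E}),
  [/\ forall i j, th i (x j) = (i == j)%:R, forall k, bounded_map (th k),
      forall k, `|x k| <= 2, forall k y, (X : set E) y -> th k y = 0 &
      forall k g, `|th k (A g)| <= rho k * `|g|].
Proof.
pose A' : {linear G -> quotient_space X} := quotient_pi X \o A.
have bA' : bounded_map A' by apply: bounded_map_comp => //; exact: bounded_quotient_pi.
have dA' : dense (range A').
  apply/dense_normP => q e e0.
  have [_ [g _ <-] qg] := (dense_normP _).1 dA (repr q) e e0.
  exists (A' g); first by exists g.
  by rewrite -[q]quotient_piK /A' /= -raddfB (le_lt_trans _ qg)// ler_quotient_pi.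
have nA' : range A' <> setT.
  move=> AT; apply: nA; apply/seteqP; split=> // y _.
  have [g _ /quotient_pi_eq /XA[g' _ gg']] : range A' (quotient_pi X y) by rewrite AT.
  by exists (g - g') => //; rewrite raddfB/= gg' opprB addrC subrK.
have [g [th [thg bth gle thle]]] := biorthogonal_system bA' dA' nA' rho_gt0.
have /choice[x xP] k : exists x : E, quotient_pi X x = A' (g k) /\ `|x| <= 2.
  have [x xg xle] := quotient_norm_lt (A' (g k)) ltr01; exists x; split=> //.
  by have := gle k; move: xle; rewrite -quotient_normE; lra.
exists x, (fun k => th k \o quotient_pi X : {scalar E}); split=> [i j|k|k|k y Xy|k h].
- by rewrite /=; have [-> _] := xP j.
- by apply: bounded_map_comp => //; exact: bounded_quotient_pi.
- by have [] := xP k.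
- by rewrite /= (quotient_pi_eq0 X y).2// raddf0.
- exact: thle.
Qed.

End Quasicomplement.

(** With k + 1 = 2^n (2m + 1), every value n recurs at arbitrarily large indices. *)
Lemma logn2_infinitely_often (n m : nat) :
  exists2 k, (m <= k)%N & logn 2 k.+1 = n.
Proof.
exists (2 ^ n * m.*2.+1).-1.
  rewrite -ltnS prednK ?muln_gt0 ?expn_gt0//.
  have : (1 * m.*2.+1 <= 2 ^ n * m.*2.+1)%N by rewrite leq_pmul2r// expn_gt0.
  rewrite mul1n; apply: leq_trans; rewrite ltnS -addnn leq_addr//.
rewrite prednK ?muln_gt0 ?expn_gt0// lognM ?expn_gt0// pfactorK//.
by rewrite (_ : logn 2 m.*2.+1 = 0%N) ?addn0// lognE /= dvdn2 /= odd_double.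
Qed.

(** A bootstrap: in the j-th relation the terms before j vanish and the tail is dominated by the
    diagonal term, so a uniform bound [D] on [s] improves to [D / 2], and iteration leaves only
    0. *)
Lemma triangular_combination_eq0 (R : realType) (E : normedModType R)
    (z : nat -> E) (h : nat -> {scalar E}) (s : nat -> R) (C : R) :
  (forall k, `|z k| = 1) -> (forall i k, (i < k)%N -> h i (z k) = 0) ->
  (forall k, 2^-1 ^+ k <= `|h k (z k)|) -> (forall k y, `|h k y| <= 2 * `|y|) ->
  (forall k, `|s k| <= C) ->
  (forall j, (\sum_(0 <= k < n) decay R k * h k (z j) * s k) @[n --> \oo] --> 0) ->
  forall k, s k = 0.
Proof.
move=> z1 hz hlow hup sC s0.
have halve D : (forall k, `|s k| <= D) -> forall k, `|s k| <= D / 2.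
  move=> sD j.
  have D0 : 0 <= D by exact: le_trans (normr_ge0 _) (sD 0%N).
  have w0 : 0 < 2^-1 ^+ j * decay R j by rewrite mulr_gt0 ?decay_gt0// exprn_gt0// invr_gt0.
  suff : 2^-1 ^+ j * decay R j * `|s j| <= 2^-1 ^+ j * decay R j * (D / 2).
    by rewrite ler_pM2l.
  apply/ler_addgt0Pr => e e0.
  have /cvgrPdist_lt/(_ _ e0)[N _ Ns] := s0 j.
  pose n := maxn N j.+1.
  have jn : (j < n)%N by rewrite leq_maxr.
  have := Ns n (leq_maxl _ _); rewrite sub0r normrN.
  rewrite (@big_cat_nat _ _ _ j)//= 1?ltnW// big1_seq ?add0r; last first.
    move=> k /andP[_]; rewrite mem_index_iota => /andP[_ kj].
    by rewrite hz// mulr0 mul0r.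
  rewrite big_ltn//.
  set u := decay R j * _ * _; set t := \sum_(_ <= _ < _) _ => ut.
  (* The tail is at most 2 [decay (j+1)] times 2D, that is, an eighth of [D] times 2^-j
     [decay j]. *)
  have tle : `|t| <= 2^-1 ^+ j * decay R j * (D / 2).
    rewrite (le_trans (ler_norm_sum _ _ _))//.
    apply: (@le_trans _ _ (\sum_(j.+1 <= k < n) decay R k * (2 * D))).
      apply: ler_sum => k _; rewrite !normrM (gtr0_norm (decay_gt0 _ _)) -mulrA.
      rewrite ler_pM2l ?decay_gt0// ler_pM//.
      by rewrite (le_trans (hup _ _))// z1 mulr1.
    rewrite -mulr_suml (le_trans (ler_wpM2r _ (decay_tail R jn)))// ?mulr_ge0//.
    rewrite decay_next; set w := _ * decay R j.
    have : 0 <= w * D by rewrite mulr_ge0// ltW.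
    lra.
  have ule : 2^-1 ^+ j * decay R j * `|s j| <= `|u|.
    rewrite /u !normrM (gtr0_norm (decay_gt0 _ _)) ler_wpM2r// mulrC.
    by rewrite ler_pM2l ?decay_gt0.
  have := ler_normD (u + t) (- t); rewrite addrK normrN; lra.
have small m k : `|s k| <= C * 2^-1 ^+ m.
  elim: m k => [|m ih] k; first by rewrite mulr1.
  by rewrite exprSr mulrA; exact: halve.
move=> k; apply/eqP; rewrite -normr_le0; apply/ler_addgt0Pr => e e0; rewrite add0r.
have [m _ /(_ m (leqnn m)) /= Cm] := half_pow_small C e0.
exact: le_trans (small m k) (ltW Cm).
Qed.

(** * The quasicomplement built from a total sequence *)

Lemma quasicomplement_of_total (R : realType) (E : completeNormedModType R)
    (f : nat -> {scalar E}) (X : closedSubspace E) (S : set E) :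
  (forall n x, `|f n x| <= `|x|) -> (forall x, (forall n, f n x = 0) -> x = 0) ->
  infinite_dimensional (X : set E) -> proper_dense_operator_range S ->
  (X : set E) `<=` S ->
  exists Y : closedSubspace E, quasicomplement X Y /\ S `&` (Y : set E) = [set 0].
Proof.
move=> fle ftot infX [[G [A [cA SA]]] nS dS] XS.
have bA := continuous_bounded_map cA.
(* Each [f n] is repeated infinitely often, so it is the limit of its perturbations [h k] although
   each single one differs from it. *)
have [z [h zhP]] := triangular_perturbation (fun k => f (logn 2 k.+1)) infX.
(* The factor 2^-k beyond the weight [decay k] of [T] survives division by that weight and makes
   [h k y] tend to 0 on the intersection of S and Y. *)
pose rho k : R := 2^-1 ^+ k * decay R k.
have half_gt0 k : 0 < 2^-1 ^+ k :> R by rewrite exprn_gt0// invr_gt0.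
have half_le1 k : 2^-1 ^+ k <= 1 :> R by rewrite exprn_ile1 ?invr_ge0// invf_le1// ler1n.
have rho_gt0 k : 0 < rho k by rewrite mulr_gt0 ?decay_gt0.
subst S.
have [x [th [thx bth xle thX thA]]] := biorthogonal_mod_subspace bA dS nS XS rho_gt0.
have hle k y : `|h k y| <= 2 * `|y|.
  have [_ _ _ _ /(_ y) hk] := zhP k.
  have := ler_normD (h k y - f (logn 2 k.+1) y) (f (logn 2 k.+1) y).
  rewrite subrK; have := fle (logn 2 k.+1) y.
  have := ler_wpM2r (normr_ge0 y) (half_le1 k); lra.
pose c y k := decay R k * h k y.
(* Here 1/8 is 2 times 1/16; with [|x k| <= 2] the norm bound for weighted sums becomes 2 * 1/8 * 2
   = 1/2. *)
have cle y k : `|c y k| <= (8^-1 * `|y|) * 2^-1 ^+ k.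
  rewrite /c normrM (gtr0_norm (decay_gt0 _ _)).
  have := ler_pM (ltW (decay_gt0 R k)) (normr_ge0 _) (decay_le R k) (hle k y).
  move=> /le_trans; apply; rewrite mulrACA -mulrA (mulrC _ `|y|) !mulrA.
  by rewrite ler_pM2r//; have := normr_ge0 y; lra.
pose T y := weighted_sum x (c y).
have lT : linear T.
  move=> a y w; rewrite /T -(weighted_sum_linear xle a (cle y) (cle w)).
  congr (weighted_sum x _); apply/funext => k; rewrite /c linearP/= mulrDr mulrCA//.
have Tle y : `|T y| <= 2^-1 * `|y|.
  by rewrite (le_trans (weighted_sum_norm xle (cle y)))//; lra.
have T0 : T 0 = 0 by exact: (raddf0 (linear_of lT)).
have lU : linear (fun y => y - T y).
  by move=> a y w; rewrite lT opprD addrACA -scalerBr.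
pose U : {linear E -> E} := linear_of lU.
have bU : bounded_map U.
  exists (1 + 2^-1) => y; rewrite (le_trans (ler_normB _ _))// mulrDl mul1r.
  by rewrite lerD2l.
have Ulow y : `|y| <= 2 * `|U y|.
  have := ler_normD (y - T y) (T y); rewrite subrK; have := Tle y; rewrite /U/=; lra.
have Usurj w : exists y, U y = w.
  have : range U w.
    (* The vector u is its own approximate preimage, since u - U u = T u has norm at most half that
       of u. *)
    rewrite (@surjective_of_approximation _ _ _ U 1 bU)// => u.
    by exists u; rewrite mul1r lexx /U/= opprB addrC subrK.
  by move=> [y _ <-]; exists y.
have thT k y : th k (T y) = c y k by exact: (weighted_sum_coord xle bth thx (cle y)).
pose thU k : {scalar E} := th k \o U.
have bthU k : bounded_map (thU k) by exact: bounded_map_comp.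
pose Y := kernel_subspace bthU; pose N := kernel_subspace bth.
have YP y : (Y : set E) y <-> (N : set E) (U y) by [].
have XN y : (X : set E) y -> (N : set E) y by move=> Xy; apply/kernel_subspaceE => k; exact: thX.
have SY : range A `&` (Y : set E) = [set 0].
  apply/seteqP; split=> [_ [[g _ <-] Yy]|_ ->]; last first.
    by split; [exists 0; rewrite ?raddf0|exact: closedSubspace0].
  set y := A g in Yy *; apply: ftot => n; apply/eqP; rewrite -normr_le0.
  apply/ler_addgt0Pr => e e0; rewrite add0r.
  have [m _ mP] := half_pow_small (`|g| + `|y|) e0.
  have [k mk kn] := logn2_infinitely_often n m.
  have hk : `|h k y| <= 2^-1 ^+ k * `|g|.
    have : th k y = c y k.
      by have := Yy k; rewrite /thU /= raddfB/= thT => /eqP; rewrite subr_eq0 => /eqP.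
    move=> thy; have := thA k g; rewrite -/y thy /c /rho normrM (gtr0_norm (decay_gt0 _ _)).
    by rewrite (mulrC (2^-1 ^+ k)) -mulrA ler_pM2l// decay_gt0.
  have [_ _ _ _ /(_ y)] := zhP k; rewrite kn distrC => fh.
  have := ler_normD (f n y - h k y) (h k y); rewrite subrK.
  by have := mP k mk; rewrite /= mulrDl; lra.
exists Y; split=> //; split; last first.
  apply/seteqP; split=> [y [Xy Yy]|_ ->].
    by rewrite -SY; split=> //; exact: XS.
  by split; exact: closedSubspace0.
(* This is T X + N. It is also the image of X + Y under [U], because [U] is the identity minus [T]
   and [X] is contained in [N]. *)
pose D := [set w | exists y, (X : set E) y /\ (N : set E) (w - T y)].
have dD : dense D.
  apply: submod_dense => [|a w w' [y [Xy Nw]] [y' [Xy' Nw']]|phi bphi phiD].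
  - exists 0; split; first exact: closedSubspace0.
    by rewrite T0 subrr; exact: closedSubspace0.
  - exists (a *: y + y'); split; first exact: closedSubspaceZD.
    by rewrite lT opprD addrACA -scalerBr; exact: closedSubspaceZD.
  have phiN w : (N : set E) w -> phi w = 0.
    move=> Nw; apply: phiD; exists 0; split; first exact: closedSubspace0.
    by rewrite T0 subr0.
  have [B B0 phiB] := bounded_map_gt0 bphi.
  have phix k : phi (x k) = 0.
    apply: (@triangular_combination_eq0 _ _ z h (fun k => phi (x k)) (B * 2)) => //.
    - by move=> k'; have [] := zhP k'.
    - by move=> i k' ik; have [_ _ hz _ _] := zhP k'; exact: hz.
    - by move=> k'; have [] := zhP k'.
    - by move=> k'; rewrite (le_trans (phiB _))// ler_pM2l.
    - move=> j; have Tz : phi (T (z j)) = 0.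
        apply: phiD; exists (z j); split; first by have [] := zhP j.
        by rewrite subrr; exact: closedSubspace0.
      by have := weighted_sum_functional xle bphi (cle (z j)); rewrite -/(T _) Tz.
  have phiA g : phi (A g) = 0.
    have dle k : `|th k (A g)| <= `|g| * 2^-1 ^+ k.
      have decay1 : decay R k <= 1.
        by rewrite (le_trans (decay_le R k))//; have := half_le1 k; have := half_gt0 k; lra.
      rewrite (le_trans (thA k g))// mulrC ler_wpM2l// /rho.
      by rewrite ler_piMr// (ltW (half_gt0 k)).
    (* The expansion of [A g] along the [x k]: the difference lies in [N], where [phi] vanishes, and
       [phi] kills every [x k]. *)
    pose w := weighted_sum x (fun k => th k (A g)).
    have Nw : (N : set E) (A g - w).
      apply/kernel_subspaceE => k.
      by rewrite raddfB/= (weighted_sum_coord xle bth thx dle) subrr.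
    have := phiN _ Nw; rewrite raddfB => /eqP; rewrite subr_eq0 => /eqP ->.
    have cw := weighted_sum_functional xle bphi dle.
    apply: etrans (esym (cvg_lim (@Rhausdorff R) cw)) _; apply: cvg_lim => //.
    apply: cvg_near_cst; apply: nearW => n.
    by rewrite big1// => k _; rewrite phix mulr0.
  move=> w; apply/eqP; rewrite -normr_le0; apply/ler_addgt0Pr => e e0; rewrite add0r.
  have [_ [g _ <-] wg] := (dense_normP _).1 dS w _ (divr_gt0 e0 B0).
  have := phiB (w - A g); rewrite raddfB/= phiA subr0.
  by move: wg; rewrite ltr_pdivlMr// mulrC; lra.
apply/dense_normP => w e e0.
have [v [y [Xy Nvy]] wv] := (dense_normP _).1 dD (U w) _ (divr_gt0 e0 (ltr0n R 2)).
(* Then [U y'] lies in [N], so y' is in [Y], and [U (- y + y') = v]; the lower bound for [U] carries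
   the estimate back. *)
have [y' Uy'] := Usurj (v - T y + y).
exists (- y + y').
  exists (- y); first by rewrite -scaleN1r; exact: closedSubspaceZ.
  exists y' => //; apply/YP; rewrite Uy' -[v - T y]scale1r.
  by apply: closedSubspaceZD => //; exact: XN.
have Uv : U (- y + y') = v.
  have -> : U (- y + y') = - U y + U y' by rewrite raddfD raddfN.
  rewrite Uy' (_ : U y = y - T y)//.
  by rewrite -addrA (addrC (- T y) y) addrCA addNr addr0.
have Uwv : U (w - (- y + y')) = U w - v by rewrite raddfB -[in RHS]Uv.
rewrite (le_lt_trans (Ulow _))// Uwv mulrC -ltr_pdivlMr//.
Qed.

(** In the second assertion [X] is infinite-dimensional: for finite-dimensional [X] a
    quasicomplement has finite codimension and so meets every dense subspace of the
    infinite-dimensional [E] nontrivially. *)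
Theorem corollary4p7 (R : realType) (E : completeNormedModType R)
    (hE : has_separable_quotient E) :
  [<-> separable_space (weak_star_dual E);
       forall X : closedSubspace E,
         infinite_dimensional (X : set E) ->
         infinite_codimensional X ->
         has_separable_quotient (quotient_space X) ->
         forall S : set E, proper_dense_operator_range S ->
           (X : set E) `<=` S ->
           exists Y : closedSubspace E,
             quasicomplement X Y /\ S `&` (Y : set E) = [set 0];
       exists X : closedSubspace E,
         [/\ separable_space (set_type (X : set E)),
             infinite_codimensional X,
             has_separable_quotient (quotient_space X) &
             forall S : set E, proper_dense_operator_range S ->
               (X : set E) `<=` S ->
               exists Y : closedSubspace E,
                 quasicomplement X Y /\ S `&` (Y : set E) = [set 0]]].
Proof.
tfae.
- move=> /weak_star_separable_total[f [fle ftot]] X infX _ _ S pS XS.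
  exact: quasicomplement_of_total fle ftot infX pS XS.
- move=> h; have [X [sX infX coX qX]] := exists_separable_subspace hE.
  by exists X; split=> //; exact: h.
- by move=> [X [sX _ qX h]]; exact: total_of_quasicomplements sX qX h.
Qed.
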